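(* Let $H$ be a Hilbert module over a $C^*$-algebra. For every idempotent $Q\in\mathcal{L}(H)$, with matched projection $m(Q)$, we have $$\mathcal{R}\big[m(Q)\big]=\mathcal{R}\big(|Q^*|+|Q|+Q+Q^*\big)=\mathcal{R}\left[\big(m(Q)Q m(Q)\big)^{\frac1n}\right]$$ for every $n\in\mathbb{N}$.
   Context: $\mathcal{L}(H)$ is the $C^*$-algebra of adjointable operators on the Hilbert $C^*$-module $H$, and $I$ is the identity operator on $H$. $\mathbb{N}$ is the set of positive integers. $\mathcal{R}(\cdot)$ and $\mathcal{N}(\cdot)$ denote range and null space. $|T|=(T^*T)^{1/2}$. An idempotent is $Q\in\mathcal{L}(H)$ with $Q^2=Q$; a projection is a self-adjoint idempotent. $P_{\mathcal{R}(Q)}$ is the projection of $H$ onto the (orthogonally complemented) range of $Q$. For every idempotent $Q$ the operator $m(Q)Qm(Q)$ is positive, and its $n$-th root is that of a positive element of the $C^*$-algebra $\mathcal{L}(H)$. Definition of the matched projection $m(Q)$ of an idempotent $Q\in\mathcal{L}(H)$: if $Q$ is a projection, $m(Q)=Q$. Otherwise, $H=\mathcal{R}(Q)\dotplus\mathcal{N}(Q^* )$ is an orthogonal decomposition; let $U:H\to\mathcal{R}(Q)\oplus\mathcal{N}(Q^* )$ be the unitary $Uh=\binom{P_{\mathcal{R}(Q)}h}{(I-P_{\mathcal{R}(Q)})h}$, let $I_1$ be the identity on $\mathcal{R}(Q)$, let $A=(Q-P_{\mathcal{R}(Q)})|_{\mathcal{N}(Q^* )}:\mathcal{N}(Q^*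 )\to\mathcal{R}(Q)$ and $B=(AA^*+I_1)^{1/2}$, and set $$m(Q)=U^*\cdot\frac12\begin{pmatrix}(B+I_1)B^{-1} & B^{-1}A\\ A^*B^{-1} & A^*[B(B+I_1)]^{-1}A\end{pmatrix}\cdot U .$$ *)

(* Defs.v *)
From HB Require Import structures.
From mathcomp Require Import all_boot all_order all_algebra.
From mathcomp Require Import complex.
From mathcomp Require Import boolp classical_sets functions reals.
From mathcomp Require Import topology normedtype.

Set Implicit Arguments.
Unset Strict Implicit.
Unset Printing Implicit Defensive.

Import Order.TTheory GRing.Theory Num.Theory.
Import numFieldNormedType.Exports.

Local Open Scope classical_set_scope.
Local Open Scope ring_scope.

(* No unit is assumed, so MathComp's unital ring structures are not used for
   the product.  Norms are elements of R[i]. *)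
HB.mixin Record CompleteNormedModule_isCStarAlgebra (R : realType) A
    of CompleteNormedModule R[i] A := {
  cmul : A -> A -> A;
  cstar : A -> A;
  cmulA : associative cmul;
  cmulDl : forall a b c, cmul (a + b) c = cmul a c + cmul b c;
  cmulDr : forall a b c, cmul a (b + c) = cmul a b + cmul a c;
  cmulZl : forall (k : R[i]) a b, cmul (k *: a) b = k *: cmul a b;
  cmulZr : forall (k : R[i]) a b, cmul a (k *: b) = k *: cmul a b;
  cstarK : involutive cstar;
  cstarD : forall a b, cstar (a + b) = cstar a + cstar b;
  cstarZ : forall (k : R[i]) a, cstar (k *: a) = Num.conj k *: cstar a;
  cstarM : forall a b, cstar (cmul a b) = cmul (cstar b) (cstar a);
  cnormM : forall a b, `|cmul a b| <= `|a| * `|b|;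
  cnorm_star : forall a, `|cmul (cstar a) a| = `|a| ^+ 2
}.

#[short(type="cstarAlgType")]
HB.structure Definition CStarAlgebra (R : realType) :=
  {A of CompleteNormedModule_isCStarAlgebra R A & CompleteNormedModule R[i] A}.

Definition cpositive (R : realType) (A : cstarAlgType R) (a : A) : Prop :=
  exists b : A, a = cmul (cstar b) b.

(* A complex vector space with an A-valued form and no axioms on the form:
   exactly the data on which the notion of adjoint depends.  Besides Hilbert
   modules it is instantiated by their submodules and direct sums, with the
   induced forms. *)
HB.mixin Record hasInner (R : realType) (A : cstarAlgType R) H := {
  inner : H -> H -> A
}.

#[short(type="innerModType")]
HB.structure Definition InnerModule (R : realType) (A : cstarAlgType R) :=
  {H of hasInner R A H & GRing.Lmodule R[i] H}.

(* Right Hilbert A-modules; the inner product is linear in its second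
   argument, and H is complete for the norm |x| = |<x, x>|^(1/2). *)
HB.mixin Record InnerModule_isHilbertModule
    (R : realType) (A : cstarAlgType R) H
    of InnerModule R A H & CompleteNormedModule R[i] H := {
  ract : H -> A -> H;
  ractDl : forall x y a, ract (x + y) a = ract x a + ract y a;
  ractDr : forall x a b, ract x (a + b) = ract x a + ract x b;
  ractM : forall x a b, ract x (cmul a b) = ract (ract x a) b;
  ractZl : forall (k : R[i]) x a, ract (k *: x) a = k *: ract x a;
  ractZr : forall (k : R[i]) x a, ract x (k *: a) = k *: ract x a;
  innerDr : forall x y z : H, inner x (y + z) = inner x y + inner x z :> A;
  innerZr : forall (k : R[i]) (x y : H), inner x (k *: y) = k *: inner x y :> A;
  inner_ract : forall (x y : H) (a : A), inner x (ract y a) = cmul (inner x y) a;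
  inner_star : forall x y : H, cstar (inner x y) = inner y x :> A;
  inner_ge0 : forall x : H, cpositive (inner x x : A);
  inner_eq0 : forall x : H, inner x x = 0 :> A -> x = 0;
  hnormE : forall x : H, `|x| ^+ 2 = `|inner x x : A|
}.

#[short(type="hilbertModType")]
HB.structure Definition HilbertModule (R : realType) (A : cstarAlgType R) :=
  {H of InnerModule_isHilbertModule R A H
      & InnerModule R A H & CompleteNormedModule R[i] H}.

Section Adjoint.
Context (R : realType) (A : cstarAlgType R).

Definition is_adjoint (H K : innerModType A) (T : H -> K) (S : K -> H) : Prop :=
  forall x y, inner (T x) y = inner x (S y).

Definition adjointable (H K : innerModType A) (T : H -> K) : Prop :=
  exists S, is_adjoint T S.

(* T^*; the value 0 is used only if T has no adjoint. *)
Definition adjoint (H K : innerModType A) (T : H -> K) : K -> H :=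
  xget (fun=> 0) [set S | is_adjoint T S].

(* T = C^* C with C in L(H): the positive elements of L(H). *)
Definition op_positive (H : innerModType A) (T : H -> H) : Prop :=
  exists2 C : H -> H, adjointable C & T = adjoint C \o C.

(* The n-th root, in L(H), of a positive T; the value 0 is used only if
   there is no positive S with S^n = T. *)
Definition op_root (H : innerModType A) (n : nat) (T : H -> H) : H -> H :=
  xget (fun=> 0) [set S | op_positive S /\ iter n S = T].

Definition op_abs (H K : innerModType A) (T : H -> K) : H -> H :=
  op_root 2 (adjoint T \o T).

(* The inverse in L(H); the value 0 is used only if T is not invertible. *)
Definition op_inv (H : innerModType A) (T : H -> H) : H -> H :=
  xget (fun=> 0) [set S | [/\ adjointable S, S \o T = idfun & T \o S = idfun]].

Definition is_projection (H : innerModType A) (P : H -> H) : Prop :=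
  [/\ adjointable P, P \o P = P & adjoint P = P].

(* P_{R(T)}; the value 0 is used only if R(T) is not orthogonally
   complemented. *)
Definition range_proj (H : innerModType A) (T : H -> H) : H -> H :=
  xget (fun=> 0) [set P | is_projection P /\ range P = range T].

End Adjoint.

Section AdjointableOperators.
Context (R : realType) (A : cstarAlgType R).

(* L(H, K).  Linearity is a consequence of adjointability. *)
Record adjop (H K : hilbertModType A) := Adjop {
  adjop_fun :> H -> K;
  adjopP : adjointable adjop_fun
}.

Lemma inner_injr (H : hilbertModType A) (x y : H) :
  (forall z : H, inner z x = inner z y :> A) -> x = y.
Proof.
move=> xy; apply/eqP; rewrite -subr_eq0; apply/eqP.
apply: (@inner_eq0 R A H); rewrite -scaleN1r innerDr innerZr xy scaleN1r.
by rewrite scaleN1r subrr.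
Qed.

Lemma is_adjoint_linear (H K : hilbertModType A) (T : H -> K) (S : K -> H) :
  is_adjoint T S -> linear T.
Proof.
move=> TS; have TSC u z : inner z (T u) = inner (S z) u :> A.
  by rewrite -inner_star TS inner_star.
move=> k u v; apply: inner_injr => z.
by rewrite TSC !innerDr !innerZr !TSC.
Qed.

Lemma adjop_linear (H K : hilbertModType A) (T : adjop H K) : linear T.
Proof. by have [S] := adjopP T; exact: is_adjoint_linear. Qed.

HB.instance Definition _ (H K : hilbertModType A) (T : adjop H K) :=
  GRing.isLinear.Build R[i] H K *:%R (adjop_fun T) (adjop_linear T).

Lemma adjoint_adjointable (H K : hilbertModType A) (T : adjop H K) :
  adjointable (adjoint T).
Proof.
exists T => x y; rewrite -inner_star.
by have <- : is_adjoint T (adjoint T) := xgetPex _ (adjopP T); rewrite inner_star.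
Qed.

Definition adjop_adj (H K : hilbertModType A) (T : adjop H K) : adjop K H :=
  Adjop (adjoint_adjointable T).

End AdjointableOperators.

Section Submodule.
Context (R : realType) (A : cstarAlgType R) (H : hilbertModType A).

Record submod (p : submodClosed H) := Submod {
  submod_val : H;
  _ : submod_val \in p
}.

HB.instance Definition _ (p : submodClosed H) :=
  [isSub for @submod_val p].
HB.instance Definition _ (p : submodClosed H) :=
  [Choice of submod p by <:].
HB.instance Definition _ (p : submodClosed H) :=
  [SubChoice_isSubLmodule of submod p by <:].
HB.instance Definition _ (p : submodClosed H) :=
  hasInner.Build R A (submod p) (fun u v => inner (\val u) (\val v)).

Definition range_pred (T : adjop H H) : {pred H} :=
  fun y => `[< exists x, T x = y >].

Lemma range_pred_closed (T : adjop H H) : submod_closed (range_pred T).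
Proof.
split; first by apply/asboolP; exists 0; rewrite linear0.
move=> k _ _ /asboolP[u <-] /asboolP[v <-].
by apply/asboolP; exists (k *: u + v); rewrite linearP.
Qed.

HB.instance Definition _ (T : adjop H H) :=
  GRing.isSubmodClosed.Build R[i] H (range_pred T) (range_pred_closed T).

Definition null_pred (T : adjop H H) : {pred H} := fun x => T x == 0.

Lemma null_pred_closed (T : adjop H H) : submod_closed (null_pred T).
Proof.
split; first by apply/eqP; rewrite linear0.
move=> k u v /eqP Tu /eqP Tv.
by apply/eqP; rewrite linearP /= Tu Tv scaler0 addr0.
Qed.

HB.instance Definition _ (T : adjop H H) :=
  GRing.isSubmodClosed.Build R[i] H (null_pred T) (null_pred_closed T).

Definition range_mod (T : adjop H H) := submod (range_pred T).
Definition null_mod (T : adjop H H) := submod (null_pred T).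

HB.instance Definition _ (T : adjop H H) := InnerModule.on (range_mod T).
HB.instance Definition _ (T : adjop H H) := InnerModule.on (null_mod T).

End Submodule.

HB.instance Definition _ (R : realType) (A : cstarAlgType R)
    (H K : innerModType A) :=
  hasInner.Build R A (H * K)%type
    (fun u v => inner u.1 v.1 + inner u.2 v.2).

Section MatchedProjection.
Context (R : realType) (A : cstarAlgType R) (H : hilbertModType A).

Definition block_op (V W : innerModType A)
    (a : V -> V) (b : W -> V) (c : V -> W) (d : W -> W) :
    (V * W)%type -> (V * W)%type :=
  fun u => (a u.1 + b u.2, c u.1 + d u.2).

Variable Q : adjop H H.

Let V := range_mod Q.
Let W := null_mod (adjop_adj Q).
Let P := range_proj Q.

(* For idempotent Q the vectors P h, h - P h and (Q - P) w below do lie in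
   R(Q), N(Q^* ) and R(Q), so that insubd 0 only changes their type. *)
Definition matched_unitary : H -> (V * W)%type :=
  fun h => (insubd 0 (P h), insubd 0 (h - P h)).

Definition matched_A : W -> V :=
  fun w => insubd 0 (Q (\val w) - P (\val w)).

Definition matched_B : V -> V :=
  op_root 2 (matched_A \o adjoint matched_A + idfun).

Definition matched_block : (V * W)%type -> (V * W)%type :=
  let a := matched_A in let b := matched_B in
  block_op ((b + idfun) \o op_inv b)
           (op_inv b \o a)
           (adjoint a \o op_inv b)
           (adjoint a \o op_inv (b \o (b + idfun)) \o a).

Definition matched_projection : H -> H :=
  if `[< is_projection Q >] then (Q : H -> H)
  else adjoint matched_unitary \o ((2^-1 : R[i]) *: matched_block)
       \o matched_unitary.

End MatchedProjection.

Arguments matched_unitary {R A H} Q _.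
Arguments matched_A {R A H} Q _.
Arguments matched_B {R A H} Q _.
Arguments matched_block {R A H} Q _.

(* Main.v *)
(* An order-free route to the C*-algebra facts that are needed about L(H).
   A weak Cauchy-Schwarz inequality comes from the triangle inequality of H by
   polarization; it makes L(H) a Banach *-algebra.  If V^* V is a scalar r^2 then
   |V| <= r by the very definition of the norm of H.  Applied to p + i w with
   p^2 + w^2 = r^2 this gives sharp bounds for self-adjoint operators, so that
   squares of self-adjoint operators are positive, and Kaplansky's argument
   shows that D^* D is positive for every D.

   For an idempotent Q put G = Q + Q^* - 1, K = G^2 = 1 + (i (Q - Q^* ))^2 and
   r = K^(1/2).  Everything that commutes with K commutes with r, in particular Q
   and Q^*.  Then P = K^-1 Q Q^* and P1 = K^-1 Q^* Q are the projections onto the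
   ranges of Q and Q^*, |Q^*| = r P, |Q| = r P1, the operator B is the restriction
   of r to R(Q), and the block matrix becomes
     m = 1/2 r^-1 (1 + r)^-1 (r P + Q^* ) (r P + Q).
   It follows that m is a projection, |Q^*| + |Q| + Q + Q^* = 2 (1 + r) m and
   m Q m = 1/2 (1 + r) m, with 1 + r invertible and commuting with m; for a
   self-adjoint n-th root S of m Q m the kernel of S is that of m. *)

Require Import Defs.
From HB Require Import structures.
From mathcomp Require Import all_boot all_order all_algebra.
From mathcomp Require Import complex.
From mathcomp Require Import boolp classical_sets functions reals.
From mathcomp Require Import topology normedtype sequences.
From mathcomp Require Import ring lra.
From Stdlib Require Ncring Ncring_tac.

Set Implicit Arguments.
Unset Strict Implicit.
Unset Printing Implicit Defensive.

Import Order.TTheory GRing.Theory Num.Theory.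
Import numFieldNormedType.Exports.

Local Open Scope classical_set_scope.
Local Open Scope ring_scope.

(** * Norms and inner products *)

Lemma mulcii (R : realType) : 'i%C * 'i%C = - 1 :> R[i].
Proof. by rewrite -expr2 sqr_i. Qed.

Lemma conjci (R : realType) : Num.conj 'i%C = - 'i%C :> R[i].
Proof. by apply/eqP; rewrite eq_complex /= oppr0 !eqxx. Qed.

Section RealNorm.
Context {R : realType} {V : normedModType R[i]}.
Implicit Types x y : V.

(** Norms take values in [R[i]]; the real version makes [lra], [nra] and infima in [R]
    applicable. *)
Definition nm x : R := complex.Re `|x|.

Lemma nmE x : `|x| = (nm x)%:C%C.
Proof.
by rewrite /nm RRe_real // Num.Theory.realE normr_ge0.
Qed.

Lemma nm_ge0 x : 0 <= nm x.
Proof. by rewrite -lecR -nmE normr_ge0. Qed.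

Lemma nm0 : nm 0 = 0.
Proof. by rewrite /nm normr0. Qed.

Lemma nm_eq0 x : nm x = 0 -> x = 0.
Proof. by move=> x0; apply: normr0_eq0; rewrite nmE x0. Qed.

Lemma nmD x y : nm (x + y) <= nm x + nm y.
Proof. by rewrite -lecR rmorphD /= -!nmE ler_normD. Qed.

Lemma nmN x : nm (- x) = nm x.
Proof. by rewrite /nm normrN. Qed.

Lemma nmB x y : nm (x - y) <= nm x + nm y.
Proof. by rewrite -(nmN y) nmD. Qed.

Lemma nmZ (r : R) x : nm (r%:C%C *: x) = `|r| * nm x.
Proof.
by rewrite /nm normrZ nmE normc_def /= expr0n /= addr0 sqrtr_sqr mul0r subr0.
Qed.

Lemma nmZi x : nm ('i%C *: x) = nm x.
Proof. by rewrite /nm normrZ normc_def /= expr0n expr1n add0r sqrtr1 mul1r. Qed.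

End RealNorm.

Section WeakCauchySchwarz.
Context {R : realType} {A : cstarAlgType R} {H : hilbertModType A}.
Implicit Types x y z : H.

Lemma nm_inner x : nm (inner x x : A) = nm x ^+ 2.
Proof. by apply: complexI; rewrite rmorphXn /= -!nmE hnormE. Qed.

Lemma innerDl x y z : inner (x + y) z = inner x z + inner y z :> A.
Proof. by rewrite -inner_star innerDr cstarD !inner_star. Qed.

Lemma innerZl (k : R[i]) x y : inner (k *: x) y = Num.conj k *: inner x y :> A.
Proof. by rewrite -inner_star innerZr cstarZ inner_star. Qed.

Lemma innerNr x y : inner x (- y) = - inner x y :> A.
Proof. by rewrite -scaleN1r innerZr scaleN1r. Qed.

Lemma innerNl x y : inner (- x) y = - inner x y :> A.
Proof.
rewrite -[LHS]inner_star innerNr -scaleN1r cstarZ rmorphN rmorph1 scaleN1r.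
by rewrite inner_star.
Qed.

Lemma innerBr x y z : inner x (y - z) = inner x y - inner x z :> A.
Proof. by rewrite innerDr innerNr. Qed.

Lemma innerBl x y z : inner (x - y) z = inner x z - inner y z :> A.
Proof. by rewrite innerDl innerNl. Qed.

Lemma inner0r x : inner x 0 = 0 :> A.
Proof. by rewrite -(scale0r (0 : H)) innerZr scale0r. Qed.

Lemma inner0l x : inner 0 x = 0 :> A.
Proof.
by rewrite -inner_star inner0r; have := cstarZ 0 (0 : A); rewrite rmorph0 !scale0r.
Qed.

(* Every term of the polarization identity is the square of a norm, so the
   triangle inequality of H gives Cauchy-Schwarz up to a factor without any
   order theory on A. *)
Lemma nm_inner_sqrD_le x y : nm (inner x y : A) <= (nm x + nm y) ^+ 2.
Proof.
have pol (v : H) : inner x v + inner v x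
    = 2^-1%:C%C *: (inner (x + v) (x + v) - inner (x - v) (x - v)) :> A.
  rewrite !innerDl !innerDr !innerNl !innerNr opprK.
  have group4 (a b c d : A) : a + b + (c + d) - (a - b + (- c + d)) = (b + c) *+ 2.
    rewrite (addrC c) (addrC (- c)) [a + b + _]addrACA [a - b + _]addrACA -opprD.
    by rewrite opprB [a + d + _]addrC addrACA subrr addr0 mulr2n.
  rewrite group4 -(@scaler_nat R[i]) scalerA.
  rewrite -(rmorph_nat (real_complex R)) -rmorphM /= mulVf ?rmorph1 ?scale1r //.
  by rewrite pnatr_eq0.
have bnd (v : H) : nm v = nm y ->
    nm (inner x v + inner v x : A) <= (nm x + nm y) ^+ 2.
  move=> vy; rewrite pol nmZ gtr0_norm ?invr_gt0 // ler_pdivrMl //.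
  apply: le_trans (nmB _ _) _; rewrite !nm_inner mulr_natl mulr2n -vy.
  by rewrite lerD // lerXn2r ?nnegrE ?addr_ge0 ?nm_ge0 ?nmD ?nmB.
have -> : inner x y = 2^-1%:C%C *: ((inner x y + inner y x)
    - 'i%C *: (inner x ('i%C *: y) + inner ('i%C *: y) x)) :> A.
  have -> : 'i%C *: (inner x ('i%C *: y) + inner ('i%C *: y) x)
      = - inner x y + inner y x :> A.
    by rewrite innerZr innerZl conjci scalerDr !scalerA mulrN mulcii opprK scale1r scaleN1r.
  rewrite opprD opprK addrACA subrr addr0 -mulr2n -(@scaler_nat R[i]) scalerA.
  by rewrite -(rmorph_nat (real_complex R)) -rmorphM /= mulVf ?rmorph1 ?scale1r ?pnatr_eq0.
rewrite nmZ gtr0_norm ?invr_gt0 // ler_pdivrMl // mulr_natl mulr2n.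
apply: le_trans (nmB _ _) _; rewrite nmZi lerD ?bnd //; exact: nmZi.
Qed.

(** Rescaling [y] to the norm of [x] turns the squared sum of norms into [4 * nm x ^+ 2]. *)
Lemma nm_inner_le x y : nm (inner x y : A) <= 4 * nm x * nm y.
Proof.
have [->|x0] := eqVneq x 0; first by rewrite inner0l !nm0 mulr0 mul0r.
have [->|y0] := eqVneq y 0; first by rewrite inner0r !nm0 mulr0.
have nx : 0 < nm x by rewrite lt_neqAle nm_ge0 andbT eq_sym; apply: contra_neq x0 => /nm_eq0.
have ny : 0 < nm y by rewrite lt_neqAle nm_ge0 andbT eq_sym; apply: contra_neq y0 => /nm_eq0.
have := nm_inner_sqrD_le x ((nm x / nm y)%:C%C *: y).
rewrite innerZr !nmZ gtr0_norm ?divr_gt0 // divfK ?gt_eqF // => h.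
rewrite -(ler_pM2l (divr_gt0 nx ny)); apply: le_trans h _.
have -> : nm x / nm y * (4 * nm x * nm y) = nm x * nm x * 4 by field; rewrite gt_eqF.
lra.
Qed.

End WeakCauchySchwarz.

(** * Geometric sequences and limits *)

Section GeometricLimits.
Context {R : realType}.

Lemma geometric_lt (q e : R) : 0 <= q < 1 -> 0 < e -> exists n, q ^+ n < e.
Proof.
move=> /andP[q0 q1] e0.
have qq : `|q| < 1 by rewrite ger0_norm.
have /cvgrPdist_lt /(_ _ e0) [N _ HN] := cvg_expr qq.
exists N; have := HN N (leqnn N).
by rewrite sub0r normrN ger0_norm ?exprn_ge0.
Qed.

(** Replaces passages to the limit: identities between limits are proved below by bounding a
    difference by a decaying error. *)
Lemma le_of_geometric (q C a b : R) : 0 <= q < 1 ->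
  (forall n, a <= b + C * q ^+ n) -> a <= b.
Proof.
move=> q01 h; rewrite leNgt; apply/negP => ba.
have [C0|C0] := leP C 0.
  by have := h 0%N; rewrite expr0 mulr1 => h0; lra.
have [|n hn] := @geometric_lt q ((a - b) / C) q01; first by rewrite divr_gt0 // subr_gt0.
have := h n; rewrite leNgt => /negP; apply.
by rewrite -ltrBrDl mulrC -ltr_pdivlMr.
Qed.

Lemma geometric_cvg {V : completeNormedModType R[i]} (u : nat -> V) (C q : R) :
  0 <= q < 1 -> (forall n, nm (u n.+1 - u n) <= C * q ^+ n) ->
  exists x, forall n, nm (x - u n) <= C / (1 - q) * q ^+ n.
Proof.
move=> q01 hu; have /andP[q0 q1] := q01.
have q1' : 0 < 1 - q by rewrite subr_gt0.
have C0 : 0 <= C by have := hu 0%N; rewrite expr0 mulr1; apply: le_trans; exact: nm_ge0.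
have D0 : 0 <= C / (1 - q) by rewrite divr_ge0 // ltW.
(* The factor [1 - q ^+ m] lets the induction close with equality; it is bounded by 1 afterwards. *)
have step n m : nm (u (m + n)%N - u n) <= C / (1 - q) * q ^+ n * (1 - q ^+ m).
  elim: m => [|m IH]; first by rewrite subrr nm0 expr0 subrr mulr0.
  have -> : u (m.+1 + n)%N - u n = (u (m + n).+1 - u (m + n)%N) + (u (m + n)%N - u n).
    by rewrite addSn addrA addrNK.
  apply: le_trans (nmD _ _) _; apply: le_trans (lerD (hu _) IH) _.
  rewrite exprS exprD le_eqVlt; apply/orP; left; apply/eqP; field.
  by rewrite gt_eqF.
have dist n m : (n <= m)%N -> nm (u m - u n) <= C / (1 - q) * q ^+ n.
  move=> nm_; rewrite -(subnK nm_); apply: le_trans (step _ _) _.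
  apply: ler_piMr; first by rewrite mulr_ge0 ?exprn_ge0.
  by have := exprn_ge0 (m - n) q0; lra.
have cu : cvg (u @ \oo).
  apply/cauchy_cvgP/cauchy_ballP => e e0; near_simpl.
  have [e' e'0 ee'] : exists2 e' : R, 0 < e' & e = e'%:C%C.
    have er : e \is Num.real by exact: gtr0_real.
    by exists (complex.Re e); rewrite ?RRe_real // -ltcR RRe_real.
  have [N hN] : exists N, C / (1 - q) * q ^+ N < e' / 2.
    have [|n hn] := @geometric_lt q (e' / 2 / (C / (1 - q) + 1)) q01.
      by rewrite !divr_gt0 // ltr_wpDl.
    exists n; rewrite ltr_pdivlMr ?ltr_wpDl // in hn.
    apply: le_lt_trans hn; rewrite mulrC ler_wpM2l ?exprn_ge0 //; lra.
  exists ([set n | N <= n], [set n | N <= n])%N; first by split; exists N.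
  move=> [n m] /= [Nn Nm]; rewrite -ball_normE /= nmE ee' ltcR.
  have -> : u n - u m = (u n - u N) - (u m - u N) by rewrite opprB addrA addrNK.
  apply: le_lt_trans (nmB _ _) _.
  by apply: le_lt_trans (lerD (dist _ _ Nn) (dist _ _ Nm)) _; lra.
exists (lim (u @ \oo)) => n; apply: (@le_of_geometric 2^-1 1); first by lra.
move=> k; have k0 : 0 < (2^-1 : R) ^+ k by rewrite exprn_gt0 // invr_gt0.
have /cvgrPdist_le /(_ (2^-1 ^+ k)%:C%C) h : u @ \oo --> lim (u @ \oo) := cu.
have [|N _ HN] := h; first by rewrite ltcR.
have := HN (maxn N n) (leq_maxl _ _); rewrite nmE lecR => hk.
have -> : lim (u @ \oo) - u n
    = (lim (u @ \oo) - u (maxn N n)) + (u (maxn N n) - u n) by rewrite addrA addrNK.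
apply: le_trans (nmD _ _) _; rewrite mul1r addrC.
by apply: lerD => //; apply: dist; rewrite leq_maxr.
Qed.

End GeometricLimits.

(** * The Banach *-algebra L(H) *)

Section Boundedness.
Context {R : realType} {A : cstarAlgType R}.

Lemma adjP {H K : hilbertModType A} (T : adjop H K) x y :
  inner (T x) y = inner x (adjop_adj T y) :> A.
Proof. by have /(_ x y) := xgetPex (fun=> 0) (adjopP T). Qed.

Lemma adjPC {H K : hilbertModType A} (T : adjop H K) x y :
  inner (adjop_adj T y) x = inner y (T x) :> A.
Proof. by rewrite -[LHS]inner_star -adjP inner_star. Qed.

(* Uniform boundedness for the functionals <z, T -> = <T^* z, -> with |z| = 1,
   by a gliding hump: if |T^* z_n| grows faster than 10^n, a sum of small
   multiples of the vectors T^* z_n makes <z_n, T x> unbounded. *)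
Lemma adjop_adj_bounded {H K : hilbertModType A} (T : adjop H K) :
  exists M : R, forall z, nm (adjop_adj T z) <= M * nm z.
Proof.
apply: contrapT => unb.
pose q : R := 10^-1; have q0 : 0 < q by rewrite invr_gt0.
have q01 : 0 <= q < 1 by rewrite ltW //= invf_lt1 ?ltr0n // ltr1n.
have qn0 n : 0 < q ^+ n by rewrite exprn_gt0.
have /choice[z hz] n : exists z, nm z = 1 /\ n%:R / q ^+ n < nm (adjop_adj T z).
  apply: contrapT => nz; apply: unb; exists (n%:R / q ^+ n) => z.
  have [->|z0] := eqVneq z 0; first by rewrite linear0 !nm0 mulr0.
  have nz0 : 0 < nm z.
    by rewrite lt_neqAle nm_ge0 andbT eq_sym; apply: contra_neq z0 => /nm_eq0.
  rewrite leNgt; apply/negP => h; apply: nz; exists ((nm z)^-1%:C%C *: z).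
  rewrite linearZ /= !nmZ gtr0_norm ?invr_gt0 // mulVf ?gt_eqF //; split => //.
  by rewrite [_^-1 * _]mulrC ltr_pdivlMr.
pose b n := nm (adjop_adj T (z n)).
have b0 n : 0 < b n by apply: le_lt_trans (hz n).2; rewrite divr_ge0 // ltW.
pose f n x : A := inner (adjop_adj T (z n)) x.
pose v n := (q ^+ n / b n)%:C%C *: adjop_adj T (z n).
have fv n : nm (f n (v n)) = q ^+ n * b n.
  rewrite /f /v innerZr nmZ nm_inner -/(b n) gtr0_norm ?divr_gt0 //.
  by rewrite expr2 mulrA divfK // gt_eqF.
have nv n : nm (v n) = q ^+ n.
  by rewrite /v nmZ -/(b n) gtr0_norm ?divr_gt0 // divfK // gt_eqF.
(* Since [f n (v n)] has norm [q ^+ n * b n], at least one of [x] and [x + v n] gives [f n] at least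
   half of that norm. *)
pose step n x := if nm (f n x) < q ^+ n * b n / 2 then x + v n else x.
have step_large n x : q ^+ n * b n / 2 <= nm (f n (step n x)).
  rewrite /step; case: ifPn => [h|]; last by rewrite -leNgt.
  have : nm (f n (v n)) <= nm (f n (x + v n)) + nm (f n x).
    have vE : v n = (x + v n) - x by rewrite addrAC subrr add0r.
    by rewrite {1}vE /f innerBr nmB.
  rewrite fv; lra.
pose fix u n := if n is m.+1 then step m (u m) else 0.
have du n : nm (u n.+1 - u n) <= 1 * q ^+ n.
  rewrite /= /step mul1r; case: ifP => _; last by rewrite subrr nm0 ltW.
  by rewrite addrAC subrr add0r nv.
have [x hx] := geometric_cvg q01 du.
(* The limit differs from [u n.+1] by at most [q ^+ n / 9], which costs at most 4/9 of
   [q ^+ n * b n] against the 1/2 secured at step [n]. The remaining 1/18 and the Cauchy-Schwarz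
   factor 4 give 72. *)
have fx n : n%:R <= 72 * nm (T x).
  have e1 : nm (f n (x - u n.+1)) <= 4 * b n * (q ^+ n / 9).
    apply: le_trans (nm_inner_le _ _) _; rewrite -/(b n).
    rewrite ler_wpM2l //; first by rewrite mulr_ge0 // ltW.
    apply: le_trans (hx n.+1) _; rewrite exprS le_eqVlt; apply/orP; left.
    by apply/eqP; rewrite /q; field.
  have e2 := step_large n (u n); rewrite -[step n _]/(u n.+1) in e2.
  have e3 : nm (f n (u n.+1)) <= nm (f n x) + nm (f n (x - u n.+1)).
    have -> w : f n w = f n x - f n (x - w) by rewrite /f innerBr opprB addrCA subrr addr0.
    exact: nmB.
  have e4 : nm (f n x) <= 4 * nm (T x).
    rewrite /f adjPC; apply: le_trans (nm_inner_le _ _) _.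
    by rewrite (hz n).1 mulr1.
  have := (hz n).2; rewrite -/(b n) ltr_pdivrMr // => e5.
  have : q ^+ n * b n / 18 <= 4 * nm (T x) by lra.
  nra.
have [n hn] : exists n, 72 * nm (T x) < n%:R.
  exists (Num.Def.archi_bound (72 * nm (T x))); apply: archi_boundP.
  by rewrite mulr_ge0 // nm_ge0.
by have := lt_le_trans hn (fx n); rewrite ltxx.
Qed.

Lemma adjointK {H K : hilbertModType A} (T : adjop H K) : adjoint (adjoint T) = T :> (H -> K).
Proof.
apply/funext => x; apply: inner_injr => z.
have h := xgetPex (fun=> 0) (adjoint_adjointable T).
by rewrite -[RHS]inner_star adjP inner_star; exact/esym/h.
Qed.

Lemma adjop_bounded {H K : hilbertModType A} (T : adjop H K) :
  exists M : R, forall x, nm (T x) <= M * nm x.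
Proof.
have [M hM] := adjop_adj_bounded (adjop_adj T); exists M => x.
by have := hM x; rewrite /= adjointK.
Qed.

End Boundedness.

Section OperatorRing.
Context {R : realType} {A : cstarAlgType R} {H : hilbertModType A}.
Implicit Types S T : adjop H H.

Lemma adjop_ext S T : (forall x, S x = T x) -> S = T.
Proof.
case: S T => [f hf] [g hg] /= fg; have {fg} fg : f = g by apply/funext.
by rewrite fg in hf *; congr Adjop; exact: Prop_irrelevance.
Qed.

Lemma adjop0_subproof : adjointable (fun _ : H => 0 : H).
Proof. by exists (fun=> 0) => x y; rewrite inner0l inner0r. Qed.

Lemma adjop1_subproof : adjointable (@idfun H).
Proof. by exists idfun. Qed.

Lemma adjopN_subproof T : adjointable (fun x => - T x).
Proof. by exists (fun x => - adjop_adj T x) => x y; rewrite innerNl innerNr adjP. Qed.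

Lemma adjopD_subproof S T : adjointable (fun x => S x + T x).
Proof.
exists (fun x => adjop_adj S x + adjop_adj T x) => x y.
by rewrite innerDl innerDr !adjP.
Qed.

Lemma adjopM_subproof S T : adjointable (S \o T).
Proof. by exists (adjop_adj T \o adjop_adj S) => x y /=; rewrite !adjP. Qed.

Lemma adjopZ_subproof (k : R[i]) T : adjointable (fun x => k *: T x).
Proof.
exists (fun x => Num.conj k *: adjop_adj T x) => x y.
by rewrite innerZl innerZr adjP.
Qed.

Definition op0 : adjop H H := Adjop adjop0_subproof.
Definition op1 : adjop H H := Adjop adjop1_subproof.
Definition opN T : adjop H H := Adjop (adjopN_subproof T).
Definition opD S T : adjop H H := Adjop (adjopD_subproof S T).
Definition opM S T : adjop H H := Adjop (adjopM_subproof S T).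
Definition opZ (k : R[i]) T : adjop H H := Adjop (adjopZ_subproof k T).

HB.instance Definition _ := gen_eqMixin (adjop H H).
HB.instance Definition _ := gen_choiceMixin (adjop H H).

Lemma opDA : associative opD.
Proof. by move=> S T U; apply: adjop_ext => x /=; rewrite addrA. Qed.
Lemma opDC : commutative opD.
Proof. by move=> S T; apply: adjop_ext => x /=; rewrite addrC. Qed.
Lemma op0D : left_id op0 opD.
Proof. by move=> S; apply: adjop_ext => x /=; rewrite add0r. Qed.
Lemma opND : left_inverse op0 opN opD.
Proof. by move=> S; apply: adjop_ext => x /=; rewrite addNr. Qed.

HB.instance Definition _ := GRing.isZmodule.Build (adjop H H) opDA opDC op0D opND.

Lemma opMA : associative opM.
Proof. by move=> S T U; apply: adjop_ext. Qed.
Lemma op1M : left_id op1 opM.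
Proof. by move=> S; apply: adjop_ext. Qed.
Lemma opM1 : right_id op1 opM.
Proof. by move=> S; apply: adjop_ext. Qed.
Lemma opMDl : left_distributive opM +%R.
Proof. by move=> S T U; apply: adjop_ext. Qed.
Lemma opMDr : right_distributive opM +%R.
Proof. by move=> S T U; apply: adjop_ext => x /=; rewrite linearD. Qed.

HB.instance Definition _ :=
  GRing.Zmodule_isPzRing.Build (adjop H H) opMA op1M opM1 opMDl opMDr.

Lemma opZA a b T : opZ a (opZ b T) = opZ (a * b) T.
Proof. by apply: adjop_ext => x /=; rewrite scalerA. Qed.
Lemma op1Z : left_id 1 opZ.
Proof. by move=> T; apply: adjop_ext => x /=; rewrite scale1r. Qed.
Lemma opZDr : right_distributive opZ +%R.
Proof. by move=> a S T; apply: adjop_ext => x /=; rewrite scalerDr. Qed.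
Lemma opZDl T : {morph opZ^~ T : a b / a + b}.
Proof. by move=> a b; apply: adjop_ext => x /=; rewrite scalerDl. Qed.

HB.instance Definition _ :=
  GRing.Zmodule_isLmodule.Build R[i] (adjop H H) opZA op1Z opZDr opZDl.

Lemma opDE S T x : (S + T) x = S x + T x. Proof. by []. Qed.
Lemma opNE T x : (- T) x = - T x. Proof. by []. Qed.
Lemma opME S T x : (S * T) x = S (T x). Proof. by []. Qed.
Lemma opZE (k : R[i]) T x : (k *: T) x = k *: T x. Proof. by []. Qed.
Lemma op1E x : (1 : adjop H H) x = x. Proof. by []. Qed.

Lemma opZAl (k : R[i]) S T : k *: (S * T) = (k *: S) * T.
Proof. by apply: adjop_ext. Qed.
Lemma opZAr (k : R[i]) S T : k *: (S * T) = S * (k *: T).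
Proof. by apply: adjop_ext => x; rewrite opZE !opME opZE linearZ. Qed.

Lemma adj_unique S T : (forall x y, inner (S x) y = inner x (T y) :> A) -> adjop_adj S = T.
Proof. by move=> h; apply: adjop_ext => x; apply: inner_injr => z; rewrite -h adjP. Qed.

Lemma adjK T : adjop_adj (adjop_adj T) = T.
Proof. by apply: adj_unique => x y; rewrite adjPC. Qed.
Lemma adjD S T : adjop_adj (S + T) = adjop_adj S + adjop_adj T.
Proof. by apply: adj_unique => x y; rewrite !opDE innerDl innerDr !adjP. Qed.
Lemma adjN T : adjop_adj (- T) = - adjop_adj T.
Proof. by apply: adj_unique => x y; rewrite !opNE innerNl innerNr adjP. Qed.
Lemma adjM S T : adjop_adj (S * T) = adjop_adj T * adjop_adj S.
Proof. by apply: adj_unique => x y; rewrite !opME !adjP. Qed.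
Lemma adjZ (k : R[i]) T : adjop_adj (k *: T) = Num.conj k *: adjop_adj T.
Proof. by apply: adj_unique => x y; rewrite !opZE innerZl innerZr adjP. Qed.
Lemma adjZr (r : R) T : adjop_adj (r%:C%C *: T) = r%:C%C *: adjop_adj T.
Proof. by rewrite adjZ; congr (_ *: _); exact: conjc_real. Qed.
Lemma adj1 : adjop_adj (1 : adjop H H) = 1.
Proof. by apply: adj_unique => x y. Qed.
Lemma adjB S T : adjop_adj (S - T) = adjop_adj S - adjop_adj T.
Proof. by rewrite adjD adjN. Qed.
Lemma adjX T n : adjop_adj (T ^+ n) = adjop_adj T ^+ n.
Proof. by elim: n => [|n IH]; rewrite ?expr0 ?adj1 // exprS exprSr adjM IH. Qed.

(** Real scalars as central self-adjoint operators, so that scaling becomes a ring product. *)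
Definition rop (r : R) : adjop H H := opZ r%:C%C 1.

Lemma ropE r x : rop r x = r%:C%C *: x. Proof. by []. Qed.
Lemma rop1 : rop 1 = 1.
Proof. by apply: adjop_ext => x; rewrite ropE rmorph1 scale1r. Qed.
Lemma rop0 : rop 0 = 0.
Proof. by apply: adjop_ext => x; rewrite ropE rmorph0 scale0r. Qed.
Lemma ropD r s : rop (r + s) = rop r + rop s.
Proof. by apply: adjop_ext => x; rewrite opDE !ropE rmorphD scalerDl. Qed.
Lemma ropN r : rop (- r) = - rop r.
Proof. by apply: adjop_ext => x; rewrite opNE !ropE rmorphN scaleNr. Qed.
Lemma ropB r s : rop (r - s) = rop r - rop s.
Proof. by rewrite ropD ropN. Qed.
Lemma ropM r s : rop (r * s) = rop r * rop s.
Proof. by apply: adjop_ext => x; rewrite opME !ropE rmorphM scalerA. Qed.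
Lemma ropX r n : rop (r ^+ n) = rop r ^+ n.
Proof. by elim: n => [|n IH]; rewrite ?rop1 // !exprS ropM IH. Qed.
Lemma ropC r T : rop r * T = T * rop r.
Proof. by apply: adjop_ext => x; rewrite !opME !ropE linearZ. Qed.
Lemma ropCA r S T : S * (rop r * T) = rop r * (S * T).
Proof. by rewrite mulrA -ropC mulrA. Qed.
Lemma adj_rop r : adjop_adj (rop r) = rop r.
Proof. by rewrite [LHS]adjZr adj1. Qed.

End OperatorRing.

(* The reification of Ncring_tac is syntactic, whereas the same ring operation
   can be reached through several inheritance paths; rewriting with the
   equations below gives it a single name. *)
Section NoncommutativeRing.
Variable E : pzRingType.
Definition nczero : E := 0.
Definition ncone : E := 1.
Definition ncadd (a b : E) : E := a + b.
Definition ncmul (a b : E) : E := a * b.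
Definition ncopp (a : E) : E := - a.
Definition ncsub (a b : E) : E := a - b.
Lemma nczeroE : 0 = nczero. Proof. by []. Qed.
Lemma nconeE : 1 = ncone. Proof. by []. Qed.
Lemma ncaddE a b : a + b = ncadd a b. Proof. by []. Qed.
Lemma ncmulE a b : a * b = ncmul a b. Proof. by []. Qed.
Lemma ncoppE a : - a = ncopp a. Proof. by []. Qed.

#[global] Instance pzRing_ops :
  @Ncring.Ring_ops E nczero ncone ncadd ncmul ncsub ncopp (@eq E) :=
  @Ncring.Build_Ring_ops _ _ _ _ _ _ _ _.

#[global] Instance pzRing_ncring : Ncring.Ring (Ro := pzRing_ops).
Proof.
split => //=; try (by move=> ? ? -> ? ? ->); try by move=> ? ? ->.
- by split=> // x y z -> ->.
- exact: add0r.
- exact: addrC.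
- exact: addrA.
- exact: mul1r.
- exact: mulr1.
- exact: mulrA.
- exact: mulrDl.
- by move=> x y z; exact: mulrDr.
- exact: subrr.
Qed.
End NoncommutativeRing.

Ltac ncring :=
  rewrite ?expr2 ?mulr2n ?nczeroE ?nconeE ?ncaddE ?ncmulE ?ncoppE;
  lazymatch goal with |- @eq _ ?l ?r =>
    change (@Algebra_syntax.equality _
      (@Ncring.eq_notation _ _ _ _ _ _ _ _ (pzRing_ops _)) l r)
  end; Ncring_tac.non_commutative_ring.

(** * The operator norm, limits and fixed points in L(H) *)

Section OperatorNorm.
Context {R : realType} {A : cstarAlgType R} {H : hilbertModType A}.
Implicit Types (S T U : adjop H H) (x y : H).

Definition opn T : R := inf [set M | 0 <= M /\ forall x, nm (T x) <= M * nm x].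

Lemma opn_has_inf T : has_inf [set M | 0 <= M /\ forall x, nm (T x) <= M * nm x].
Proof.
split; last by exists 0 => M [].
have [M hM] := adjop_bounded T; exists `|M| => /=; split => // x.
by apply: le_trans (hM x) _; rewrite ler_wpM2r ?nm_ge0 ?ler_norm.
Qed.

Lemma opn_ge0 T : 0 <= opn T.
Proof. by apply: lb_le_inf; [have [] := opn_has_inf T | move=> M []]. Qed.

Lemma opn_le T (M : R) : 0 <= M -> (forall x, nm (T x) <= M * nm x) -> opn T <= M.
Proof. by move=> M0 hM; apply: ge_inf => //; have [] := opn_has_inf T. Qed.

Lemma nm_op_le T x : nm (T x) <= opn T * nm x.
Proof.
have [x0|x0] := eqVneq (nm x) 0.
  by rewrite (nm_eq0 x0) linear0 nm0 mulr0.
have xp : 0 < nm x by rewrite lt_neqAle eq_sym x0 nm_ge0.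
rewrite -ler_pdivrMr //; apply: lb_le_inf; first by have [] := opn_has_inf T.
by move=> M [M0 hM]; rewrite ler_pdivrMr.
Qed.

Lemma opn_eq0 T : opn T <= 0 -> T = 0.
Proof.
move=> T0; apply: adjop_ext => x; apply: nm_eq0; apply/eqP.
rewrite eq_le nm_ge0 andbT; apply: le_trans (nm_op_le _ _) _.
by rewrite mulr_le0_ge0 ?nm_ge0.
Qed.

Lemma opnD S T : opn (S + T) <= opn S + opn T.
Proof.
apply: opn_le => [|x]; first by rewrite addr_ge0 ?opn_ge0.
by rewrite opDE mulrDl; apply: le_trans (nmD _ _) _; rewrite lerD ?nm_op_le.
Qed.

Lemma opnN T : opn (- T) = opn T.
Proof.
have le S : opn (- S) <= opn S.
  by apply: opn_le => [|x]; rewrite ?opn_ge0 // opNE nmN nm_op_le.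
by apply/eqP; rewrite eq_le le /= -{1}(opprK T) le.
Qed.

Lemma opnB S T : opn (S - T) <= opn S + opn T.
Proof. by rewrite -(opnN T) opnD. Qed.

Lemma opnM S T : opn (S * T) <= opn S * opn T.
Proof.
apply: opn_le => [|x]; first by rewrite mulr_ge0 ?opn_ge0.
rewrite opME -mulrA; apply: le_trans (nm_op_le _ _) _.
by rewrite ler_wpM2l ?opn_ge0 ?nm_op_le.
Qed.

Lemma opn0 : opn 0 = 0.
Proof.
apply/eqP; rewrite eq_le opn_ge0 andbT; apply: opn_le => // x.
by rewrite nm0 mul0r.
Qed.

Lemma opn1_le : opn 1 <= 1.
Proof. by apply: opn_le => // x; rewrite mul1r. Qed.

Lemma opnX_le T n (M : R) : opn T <= M -> opn (T ^+ n) <= M ^+ n.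
Proof.
move=> TM; elim: n => [|n IH]; first by rewrite !expr0 opn1_le.
by rewrite !exprS; apply: le_trans (opnM _ _) _; rewrite ler_pM ?opn_ge0.
Qed.

(** By weak Cauchy-Schwarz, |T^* x|^2 = |<x, T T^* x>| is at most 4 |x| |T| |T^* x|. The factor 4 is
    harmless, as this serves only for the continuity of the adjoint. *)
Lemma opn_adj_le T : opn (adjop_adj T) <= 4 * opn T.
Proof.
apply: opn_le => [|x]; first by rewrite mulr_ge0 ?opn_ge0.
have [y0|y0] := eqVneq (nm (adjop_adj T x)) 0.
  by rewrite y0 !mulr_ge0 ?opn_ge0 ?nm_ge0.
have yp : 0 < nm (adjop_adj T x) by rewrite lt_neqAle eq_sym y0 nm_ge0.
rewrite -(ler_pM2r yp) -[leLHS]expr2 -nm_inner adjPC.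
apply: le_trans (nm_inner_le _ _) _.
rewrite -!mulrA ler_wpM2l // mulrCA ler_wpM2l ?nm_ge0 //.
by rewrite nm_op_le.
Qed.

(* If V^* V is scalar then V is a multiple of an isometry; this gives sharp
   bounds although only a weak Cauchy-Schwarz inequality is available. *)
Lemma opn_isometry T (r : R) : 0 <= r ->
  adjop_adj T * T = rop (r ^+ 2) -> opn T <= r.
Proof.
move=> r0 TT; apply: opn_le => // x.
rewrite -(ler_pXn2r (ltn0Sn 1)) ?nnegrE ?mulr_ge0 ?nm_ge0 //.
rewrite -nm_inner adjP -opME TT ropE innerZr nmZ nm_inner exprMn.
by rewrite ger0_norm // sqr_ge0.
Qed.

(** A pointwise limit is only a function, so the limit [g] of the adjoints is taken as well; it is
    the adjoint of the limit [f]. *)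
Lemma opn_complete (u : nat -> adjop H H) (C q : R) : 0 <= q < 1 ->
  (forall n, opn (u n.+1 - u n) <= C * q ^+ n) ->
  exists T, forall n, opn (T - u n) <= C / (1 - q) * q ^+ n.
Proof.
move=> q01 hu; have /andP[q0 q1] := q01.
have C0 : 0 <= C by have := hu 0%N; rewrite expr0 mulr1; apply: le_trans; exact: opn_ge0.
have q1' : 0 < 1 - q by rewrite subr_gt0.
have lim_of (v : nat -> adjop H H) (D : R) : (forall n, opn (v n.+1 - v n) <= D * q ^+ n) ->
    exists f : H -> H, forall n x, nm (f x - v n x) <= D / (1 - q) * q ^+ n * nm x.
  move=> hv; have /choice[f hf] x : exists y, forall n,
      nm (y - v n x) <= D * nm x / (1 - q) * q ^+ n.
    apply: (@geometric_cvg _ _ (fun n => v n x)) => // n.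
    apply: le_trans (nm_op_le (v n.+1 - v n) x) _.
    by rewrite mulrAC ler_wpM2r ?nm_ge0.
  exists f => n x; apply: le_trans (hf x n) _; rewrite le_eqVlt; apply/orP; left.
  by apply/eqP; ring.
have [f hf] := lim_of u C hu.
have [|g hg] := lim_of (fun n => adjop_adj (u n)) (4 * C).
  move=> n; rewrite -adjB; apply: le_trans (opn_adj_le _) _.
  by rewrite -mulrA ler_wpM2l.
have fg : is_adjoint f g.
  move=> x y; apply/eqP; rewrite -subr_eq0; apply/eqP/nm_eq0/eqP.
  rewrite eq_le nm_ge0 andbT.
  (* The constant is 4 for the term with [f] plus 4 times 4 for the term with [g], whose rate
     involves [4 * C]. *)
  apply: (@le_of_geometric _ q (20 * C / (1 - q) * nm x * nm y) _ _ q01) => n.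
  rewrite add0r.
  have -> : inner (f x) y - inner x (g y)
      = inner (f x - u n x) y - inner x (g y - adjop_adj (u n) y) :> A.
    by rewrite innerBl innerBr adjP opprB addrA addrNK.
  apply: le_trans (nmB _ _) _.
  apply: le_trans (lerD (nm_inner_le _ _) (nm_inner_le _ _)) _.
  have e1 := hf n x; have e2 := hg n y.
  have e3 : 4 * nm (f x - u n x) * nm y <= 4 * (C / (1 - q) * q ^+ n * nm x) * nm y.
    by rewrite ler_wpM2r ?nm_ge0 // ler_wpM2l.
  have e4 : 4 * nm x * nm (g y - adjop_adj (u n) y) <= 4 * nm x * (4 * C / (1 - q) * q ^+ n * nm y).
    by rewrite ler_wpM2l // mulr_ge0 ?nm_ge0.
  apply: le_trans (lerD e3 e4) _; rewrite le_eqVlt; apply/orP; left; apply/eqP; ring.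
exists (Adjop (ex_intro _ g fg)) => n; apply: opn_le => [|x].
  by rewrite mulr_ge0 ?exprn_ge0 // divr_ge0 // ltW.
exact: hf.
Qed.

(* Self-adjoint operators in the bicommutant of X. *)
Definition sbicomm (X : adjop H H) : set (adjop H H) :=
  [set Y | adjop_adj Y = Y /\ forall Z, Z * X = X * Z -> Z * Y = Y * Z].

(** Both conditions say that an operator vanishes, and its norm is at most a constant times
    [opn (Y - u n)]: 5 = 4 + 1 for [adjop_adj Y - Y], twice [opn Z] for the commutator with [Z]. *)
Lemma sbicomm_closed (X Y : adjop H H) (u : nat -> adjop H H) (C q : R) : 0 <= q < 1 ->
  (forall n, sbicomm X (u n)) -> (forall n, opn (Y - u n) <= C * q ^+ n) ->
  sbicomm X Y.
Proof.
move=> q01 hu hY.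
have zero (T : adjop H H) (D : R) : (forall n, opn T <= D * opn (Y - u n)) -> 0 <= D -> T = 0.
  move=> hT D0; apply: opn_eq0; apply: (@le_of_geometric _ q (D * C) _ _ q01) => n.
  by rewrite add0r -mulrA; apply: le_trans (hT n) _; rewrite ler_wpM2l.
split.
  apply/eqP; rewrite -subr_eq0; apply/eqP; apply: (zero _ 5) => // n.
  have -> : adjop_adj Y - Y = adjop_adj (Y - u n) - (Y - u n).
    by rewrite adjB (hu n).1 opprB addrA addrNK.
  apply: le_trans (opnB _ _) _; have := opn_adj_le (Y - u n); lra.
move=> Z ZX; apply/eqP; rewrite -subr_eq0; apply/eqP.
apply: (zero _ (opn Z + opn Z)) => [n|]; last by rewrite addr_ge0 ?opn_ge0.
have -> : Z * Y - Y * Z = Z * (Y - u n) - (Y - u n) * Z.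
  by rewrite mulrBr mulrBl ((hu n).2 Z ZX) opprB addrA addrNK.
apply: le_trans (opnB _ _) _; rewrite [leRHS]mulrDl.
by rewrite lerD // ?opnM // [leRHS]mulrC opnM.
Qed.

(** Banach's fixed point theorem on a ball around [Y0], carried out inside [sbicomm X], so that
    roots and inverses obtained from it commute with everything that commutes with [X]. *)
Lemma op_fixpoint (X Y0 : adjop H H) (F : adjop H H -> adjop H H) (r q : R) :
  0 <= q < 1 -> sbicomm X Y0 ->
  (forall Y, sbicomm X Y -> sbicomm X (F Y)) ->
  (forall Y Y', sbicomm X Y -> sbicomm X Y' -> opn (Y - Y0) <= r -> opn (Y' - Y0) <= r ->
     opn (F Y - F Y') <= q * opn (Y - Y')) ->
  opn (F Y0 - Y0) <= (1 - q) * r ->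
  exists Y, [/\ sbicomm X Y, opn (Y - Y0) <= r & F Y = Y].
Proof.
move=> q01 XY0 XF FF F0; have /andP[q0 q1] := q01.
have q1' : 0 < 1 - q by rewrite subr_gt0.
have r0 : 0 <= r by have := le_trans (opn_ge0 _) F0; rewrite pmulr_rge0.
pose u n := iter n F Y0.
have uX n : sbicomm X (u n) by elim: n => // n IH; exact: XF.
(* The two bounds are proved together: [F] contracts only inside the ball, so the step sizes are
   controlled only while the iterates stay there. *)
have [uY0 du] : (forall n, opn (u n - Y0) <= r * (1 - q ^+ n)) /\
    (forall n, opn (u n.+1 - u n) <= (1 - q) * r * q ^+ n).
  have both n : opn (u n - Y0) <= r * (1 - q ^+ n) /\
      opn (u n.+1 - u n) <= (1 - q) * r * q ^+ n; last by split=> n; have [] := both n.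
  elim: n => [|n [IH1 IH2]].
    by rewrite /= subrr opn0 expr0 subrr mulr0 mulr1.
  have le_r m : r * (1 - q ^+ m) <= r by have := exprn_ge0 m q0; nra.
  have IH3 : opn (u n.+1 - Y0) <= r * (1 - q ^+ n.+1).
    have -> : u n.+1 - Y0 = (u n.+1 - u n) + (u n - Y0) by rewrite addrA addrNK.
    apply: le_trans (opnD _ _) _; apply: le_trans (lerD IH2 IH1) _.
    by rewrite exprS le_eqVlt; apply/orP; left; apply/eqP; ring.
  split => //.
  have step := FF _ _ (uX n.+1) (uX n) (le_trans IH3 (le_r _)) (le_trans IH1 (le_r _)).
  apply: le_trans step _.
  by rewrite exprS mulrCA ler_wpM2l.
have [Y hY] := opn_complete q01 du.
have {}hY n : opn (Y - u n) <= r * q ^+ n.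
  by apply: le_trans (hY n) _; rewrite [_ * r]mulrC mulfK ?gt_eqF.
have YX : sbicomm X Y by exact: (sbicomm_closed q01 uX hY).
have Yr : opn (Y - Y0) <= r by have := hY 0%N; rewrite expr0 mulr1.
exists Y; split => //; apply/eqP; rewrite -subr_eq0; apply/eqP/opn_eq0.
apply: (@le_of_geometric _ q (2 * r) _ _ q01) => n; rewrite add0r.
have -> : F Y - Y = (F Y - F (u n)) - (Y - u n.+1) by rewrite opprB addrA addrNK.
apply: le_trans (opnB _ _) _.
have e1 : opn (F Y - F (u n)) <= q * opn (Y - u n).
  apply: FF => //; apply: le_trans (uY0 n) _.
  by have := exprn_ge0 n q0; nra.
have e2 := hY n; have e3 := hY n.+1; rewrite exprS in e3.
have := exprn_ge0 n q0; have := opn_ge0 (Y - u n); nra.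
Qed.

End OperatorNorm.

(** * Roots and positivity *)

Section Roots.
Context {R : realType} {A : cstarAlgType R} {H : hilbertModType A}.
Implicit Types (S T X Y Z : adjop H H).

(** [X] commutes with itself, so [Y] commutes with [X] and therefore with [Z]. *)
Lemma sbicomm_comm X Y Z : sbicomm X Y -> sbicomm X Z -> Y * Z = Z * Y.
Proof. by move=> [_ Y2] [_ Z2]; apply: Z2; rewrite (Y2 X). Qed.

Lemma sbicomm_refl X : adjop_adj X = X -> sbicomm X X.
Proof. by []. Qed.

Lemma sbicomm_sub X Y Z : sbicomm X Y -> sbicomm Y Z -> sbicomm X Z.
Proof. by move=> [_ Y2] [Z1 Z2]; split=> // W /Y2 /Z2. Qed.

Lemma sbicommD X Y Z : sbicomm X Y -> sbicomm X Z -> sbicomm X (Y + Z).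
Proof.
move=> [Y1 Y2] [Z1 Z2]; split; first by rewrite adjD Y1 Z1.
by move=> W WX; rewrite mulrDr mulrDl Y2 ?Z2.
Qed.

Lemma sbicommN X Y : sbicomm X Y -> sbicomm X (- Y).
Proof.
move=> [Y1 Y2]; split; first by rewrite adjN Y1.
by move=> W WX; rewrite mulrN mulNr Y2.
Qed.

Lemma sbicommB X Y Z : sbicomm X Y -> sbicomm X Z -> sbicomm X (Y - Z).
Proof. by move=> hY hZ; apply: sbicommD => //; exact: sbicommN. Qed.

Lemma sbicommM X Y Z : sbicomm X Y -> sbicomm X Z -> sbicomm X (Y * Z).
Proof.
move=> hY hZ; have YZ := sbicomm_comm hY hZ; case: hY hZ => [Y1 Y2] [Z1 Z2].
split; first by rewrite adjM Y1 Z1 YZ.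
by move=> W WX; rewrite mulrA Y2 // -mulrA Z2 // mulrA.
Qed.

Lemma sbicomm_rop X (r : R) : sbicomm X (rop r).
Proof. by split=> [|W _]; rewrite ?adj_rop ?ropC. Qed.

Lemma sbicomm1 X : sbicomm X 1.
Proof. by rewrite -rop1; exact: sbicomm_rop. Qed.

Lemma sbicommX X Y n : sbicomm X Y -> sbicomm X (Y ^+ n).
Proof.
by move=> hY; elim: n => [|n IH]; [exact: sbicomm1 | rewrite exprS; exact: sbicommM].
Qed.

Lemma opn_rop_le (r : R) : 0 <= r -> opn (rop r : adjop H H) <= r.
Proof. by move=> r0; apply: opn_le => // x; rewrite ropE nmZ ger0_norm. Qed.

Lemma opn_ropM_le (r : R) T : 0 <= r -> opn (rop r * T) <= r * opn T.
Proof.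
by move=> r0; apply: le_trans (opnM _ _) _; rewrite ler_wpM2r ?opn_ge0 ?opn_rop_le.
Qed.

Lemma rop_unitK (r : R) T : r != 0 -> rop r * (rop r^-1 * T) = T.
Proof. by move=> r0; rewrite mulrA -ropM mulfV // rop1 mul1r. Qed.

(** The inverse is the fixed point of [Y |-> 1 + X * Y] in the ball of radius [(1 - r)^-1] around
    0. *)
Lemma neumann X (r : R) : adjop_adj X = X -> opn X <= r -> r < 1 ->
  exists Y, [/\ sbicomm X Y, opn Y <= (1 - r)^-1 & (1 - X) * Y = 1].
Proof.
move=> Xsa Xr r1; have r0 : 0 <= r := le_trans (opn_ge0 _) Xr.
have X0 : sbicomm X 0 by rewrite -rop0; exact: sbicomm_rop.
have [||||Y [YX Yr FY]] :=
  @op_fixpoint _ _ _ X 0 (fun Y => 1 + X * Y) (1 - r)^-1 r _ X0.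
- by rewrite r0.
- by move=> Y YX; apply: sbicommD (sbicomm1 _) (sbicommM _ YX).
- move=> Y Y' _ _ _ _; rewrite opprD addrACA subrr add0r -mulrBr.
  by apply: le_trans (opnM _ _) _; rewrite ler_wpM2r ?opn_ge0.
- by rewrite mulr0 addr0 subr0 mulfV ?opn1_le // gt_eqF // subr_gt0.
exists Y; split => //; first by rewrite -[Y]subr0.
by rewrite mulrBl mul1r -{1}FY addrK.
Qed.

(* On the ball of radius e <= 1 around 1 the map Z |-> Z^n - n Z is Lipschitz
   with constant O(e), hence Z |-> Z - (Z^n - T)/n is a contraction. *)
Lemma exprn_near1 n : exists K : R, 0 <= K /\ forall (e : R) Z, 0 <= e <= 1 ->
  opn (Z - 1) <= e -> opn (Z ^+ n - 1) <= K * e.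
Proof.
elim: n => [|n [K [K0 IH]]].
  by exists 0; split => // e Z _ _; rewrite expr0 subrr opn0 mul0r.
exists (2 * K + 1); split => [|e Z e01 Ze]; first lra.
have /andP[e0 e1] := e01.
have -> : Z ^+ n.+1 - 1 = (Z - 1) * (Z ^+ n - 1) + (Z ^+ n - 1) + (Z - 1).
  by rewrite exprS; ncring.
apply: le_trans (opnD _ _) _; apply: le_trans (lerD (opnD _ _) (lexx _)) _.
have h1 := IH e Z e01 Ze; have h2 := opnM (Z - 1) (Z ^+ n - 1).
have h3 : opn (Z - 1) * opn (Z ^+ n - 1) <= 1 * (K * e).
  by apply: ler_pM; rewrite ?opn_ge0 //; exact: le_trans e1.
lra.
Qed.

Lemma exprn_lipschitz n : exists K : R, 0 <= K /\ forall (e : R) Z Z', 0 <= e <= 1 ->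
  opn (Z - 1) <= e -> opn (Z' - 1) <= e ->
  opn (Z ^+ n - Z' ^+ n - rop n%:R * (Z - Z')) <= K * e * opn (Z - Z').
Proof.
elim: n => [|n [K [K0 IH]]].
  by exists 0; split => // e Z Z' _ _ _; rewrite !expr0 rop0 mul0r !subrr opn0 !mul0r.
have [P [P0 hP]] := exprn_near1 n.
exists (2 * K + n%:R + P); split => [|e Z Z' e01 Ze Ze']; first by rewrite !addr_ge0 ?mulr_ge0.
have /andP[e0 e1] := e01.
have -> : Z ^+ n.+1 - Z' ^+ n.+1 - rop n.+1%:R * (Z - Z')
    = (Z - 1) * (Z ^+ n - Z' ^+ n - rop n%:R * (Z - Z'))
      + (Z ^+ n - Z' ^+ n - rop n%:R * (Z - Z'))
      + rop n%:R * ((Z - 1) * (Z - Z')) + (Z - Z') * (Z' ^+ n - 1).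
  rewrite !exprS -(addn1 n) natrD ropD rop1.
  have -> : rop n%:R * ((Z - 1) * (Z - Z')) = (Z - 1) * (rop n%:R * (Z - Z')).
    by rewrite mulrA ropC -mulrA.
  ncring.
set D := _ - rop n%:R * (Z - Z'); have hD : opn D <= K * e * opn (Z - Z') := IH e Z Z' e01 Ze Ze'.
set d := opn (Z - Z'); have d0 : 0 <= d := opn_ge0 _.
have f1 : opn ((Z - 1) * D) <= 1 * (K * e * d).
  by apply: le_trans (opnM _ _) _; apply: ler_pM; rewrite ?opn_ge0 //; exact: le_trans e1.
have f2 : opn (rop n%:R * ((Z - 1) * (Z - Z'))) <= n%:R * (e * d).
  apply: le_trans (opn_ropM_le _ _) _ => //; rewrite ler_wpM2l //.
  by apply: le_trans (opnM _ _) _; rewrite ler_wpM2r.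
have f3 : opn ((Z - Z') * (Z' ^+ n - 1)) <= d * (P * e).
  by apply: le_trans (opnM _ _) _; rewrite ler_wpM2l // hP.
have f4 := opnD ((Z - 1) * D) D.
have f5 := opnD ((Z - 1) * D + D) (rop n%:R * ((Z - 1) * (Z - Z'))).
apply: le_trans (opnD _ _) _; lra.
Qed.

Lemma root_near1 n : (0 < n)%N -> exists d : R, 0 < d /\ forall X,
  adjop_adj X = X -> opn X <= d -> exists Z, sbicomm X Z /\ Z ^+ n = 1 - X.
Proof.
move=> n0; have [K [K0 hK]] := exprn_lipschitz n.
(* This radius gives [K * e <= 1/2], so that [F] below contracts by 1/2; the bound [e / 2] on [X]
   controls its first step. *)
pose e : R := (2 * K + 1)^-1; have K1 : 0 < 2 * K + 1 by lra.
have e0 : 0 < e by rewrite invr_gt0.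
have e01 : 0 <= e <= 1 by rewrite ltW //= invf_le1 //; lra.
have n1 : 1 <= n%:R :> R by rewrite ler1n.
have nn0 : n%:R != 0 :> R by rewrite gt_eqF //; lra.
have ni : 0 <= (n%:R^-1 : R) <= 1 by rewrite invr_ge0 ler0n invf_le1 //; lra.
have /andP[ni0 ni1] := ni.
exists (e / 2); split=> [|X Xsa Xd]; first by rewrite divr_gt0.
(* Newton's iteration for [Z ^+ n = 1 - X], with the derivative frozen at its value [n] at 1. *)
pose F Z := Z - rop n%:R^-1 * (Z ^+ n - (1 - X)).
have [||||Z [ZX _ FZ]] := @op_fixpoint _ _ _ X 1 F e 2^-1 _ (sbicomm1 X).
- lra.
- move=> Z ZX; apply: sbicommB => //; apply: sbicommM; first exact: sbicomm_rop.
  apply: sbicommB; first exact: sbicommX.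
  exact: sbicommB (sbicomm1 _) _.
- move=> Z Z' _ _ Ze Ze'.
  have -> : F Z - F Z' = - (rop n%:R^-1 * (Z ^+ n - Z' ^+ n - rop n%:R * (Z - Z'))).
    by rewrite /F [in RHS]mulrBr [in RHS]mulrA -ropM mulVf // rop1; ncring.
  rewrite opnN; apply: le_trans (opn_ropM_le _ _) _ => //.
  have h := hK e Z Z' e01 Ze Ze'; set d := opn (Z - Z') in h *.
  have d0 : 0 <= d := opn_ge0 _.
  have Ke : K * e <= 2^-1.
    rewrite /e ler_pdivrMr //; lra.
  have h2 : K * e * d <= 2^-1 * d by rewrite ler_wpM2r.
  by apply: le_trans (ler_piMl _ ni1) _; rewrite ?opn_ge0 //; apply: le_trans h2.
- have -> : F 1 - 1 = - (rop n%:R^-1 * X) by rewrite /F expr1n; ncring.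
  rewrite opnN; apply: le_trans (opn_ropM_le _ _) _ => //.
  by apply: le_trans (ler_piMl (opn_ge0 _) ni1) _; lra.
exists Z; split => //; apply/eqP; rewrite -subr_eq0; apply/eqP.
rewrite -(rop_unitK (Z ^+ n - (1 - X)) nn0).
have -> : rop n%:R^-1 * (Z ^+ n - (1 - X)) = Z - F Z by rewrite /F subKr.
by rewrite FZ subrr mulr0.
Qed.

(* 1 - X is the product of the N factors (1 - ((j+1)/N) X) (1 - (j/N) X)^-1, all
   close to 1 for large N. *)
Lemma root_1B n X : (0 < n)%N -> adjop_adj X = X -> opn X < 1 ->
  exists Z, sbicomm X Z /\ Z ^+ n = 1 - X.
Proof.
move=> n0 Xsa X1; have [d [d0 hd]] := root_near1 n0.
set r := opn X in X1; have r0 : 0 <= r := opn_ge0 _.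
have r1 : 0 < 1 - r by rewrite subr_gt0.
have [N [N0 hN]] : exists N, (0 < N)%N /\ r / (1 - r) / d <= N%:R.
  exists (Num.Def.archi_bound (r / (1 - r) / d)).+1; split=> //.
  have b0 : 0 <= r / (1 - r) / d by rewrite !divr_ge0 // ltW.
  by apply: le_trans (ltW (archi_boundP b0)) _; rewrite ler_nat.
have N0' : 0 < N%:R :> R by rewrite ltr0n.
have small : N%:R^-1 * (r / (1 - r)) <= d.
  by rewrite mulrC ler_pdivrMr // [d * _]mulrC -ler_pdivrMr.
suff main j : (j <= N)%N -> exists Z, sbicomm X Z /\ Z ^+ n = 1 - rop (j%:R / N%:R) * X.
  by have := main N (leqnn _); rewrite divff ?gt_eqF // rop1 mul1r.
elim: j => [_|j IH jN].
  by exists 1; rewrite expr1n mul0r rop0 mul0r subr0; split => //; exact: sbicomm1.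
have [Z [ZX Zn]] := IH (ltnW jN).
pose t : R := j%:R / N%:R.
have t01 : 0 <= t <= 1 by rewrite divr_ge0 //= ler_pdivrMr // mul1r ler_nat ltnW.
have /andP[t0 t1] := t01.
have tX : sbicomm X (rop t * X) by apply: sbicommM => //; exact: sbicomm_rop.
have [|Y [YX Yr Y1]] := @neumann (rop t * X) r tX.1 _ X1.
  by apply: le_trans (opn_ropM_le _ t0) _; rewrite ler_piMl.
have {}YX := sbicomm_sub tX YX.
(* [1 - W] is the next factor: (1 - t X)(1 - W) = 1 - (t + 1/N) X. The choice of [N] makes [W] small
   enough for [root_near1]. *)
pose W := rop N%:R^-1 * (X * Y).
have WX : sbicomm X W.
  by apply: sbicommM (sbicomm_rop _ _) (sbicommM _ YX).
have Wd : opn W <= d.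
  have Ni : 0 <= N%:R^-1 :> R by rewrite invr_ge0 ltW.
  apply: le_trans small; apply: le_trans (opn_ropM_le _ Ni) _.
  rewrite ler_wpM2l //; apply: le_trans (opnM _ _) _.
  by rewrite ler_wpM2l.
have [V [VW Vn]] := hd W WX.1 Wd.
have VX := sbicomm_sub WX VW.
exists (Z * V); split; first exact: sbicommM.
rewrite exprMn_comm; last exact: sbicomm_comm ZX VX.
rewrite Zn Vn mulrBr mulr1 -/t.
have -> : (1 - rop t * X) * W = rop N%:R^-1 * X.
  have cX : (1 - rop t * X) * X = X * (1 - rop t * X).
    by apply: (@sbicomm_comm X) => //; apply: sbicommB => //; exact: sbicomm1.
  by rewrite /W ropCA [(1 - _) * (X * Y)]mulrA cX -[X * _ * Y]mulrA Y1 mulr1.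
have -> : rop (j.+1%:R / N%:R) = rop t + rop N%:R^-1 :> adjop H H.
  by rewrite -ropD -(addn1 j) natrD mulrDl mul1r.
ncring.
Qed.

End Roots.

(** * Positive operators and Kaplansky's argument *)

Section Positivity.
Context {R : realType} {A : cstarAlgType R} {H : hilbertModType A}.
Implicit Types (S T X Y Z p w h D : adjop H H).

(* For self-adjoint T this says that the spectrum of T is nonnegative. *)
Definition pos T : Prop := exists t : R, opn (rop t - T) <= t.

Lemma pos_shift T (t t' : R) : opn (rop t - T) <= t -> t <= t' -> opn (rop t' - T) <= t'.
Proof.
move=> h tt'; have -> : rop t' - T = rop (t' - t) + (rop t - T) by rewrite ropB addrA addrNK.
apply: le_trans (opnD _ _) _; have : 0 <= t' - t by rewrite subr_ge0.
by move=> /(@opn_rop_le _ _ H); lra.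
Qed.

Lemma posD S T : pos S -> pos T -> pos (S + T).
Proof.
move=> [s hs] [t ht]; exists (s + t).
have -> : rop (s + t) - (S + T) = (rop s - S) + (rop t - T) by rewrite ropD opprD addrACA.
by apply: le_trans (opnD _ _) _; rewrite lerD.
Qed.

Lemma posZ (r : R) T : 0 <= r -> pos T -> pos (rop r * T).
Proof.
move=> r0 [t ht]; exists (r * t).
rewrite ropM -mulrBr; apply: le_trans (opn_ropM_le _ r0) _.
by rewrite ler_wpM2l.
Qed.

(** Adding [e] makes the inequality strict, as [root_1B] and [neumann] require. Its validity for all
    larger shifts lets the shift be an [n]-th power. *)
Lemma pos_shiftD (e : R) T : 0 < e -> pos T -> exists s : R,
  [/\ 1 <= s, opn (rop s - (rop e + T)) < s & forall s', s <= s' ->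
      opn (rop s' - (rop e + T)) < s'].
Proof.
move=> e0 [t ht]; exists (1 + `|t| + e).
have main s' : 1 + `|t| + e <= s' -> opn (rop s' - (rop e + T)) < s'.
  move=> ss'; have -> : rop s' - (rop e + T) = rop (s' - e) - T by rewrite ropB opprD addrA.
  have le_t : t <= s' - e by have := ler_norm t; lra.
  by have := pos_shift ht le_t; lra.
by split => //; [have := normr_ge0 t; lra | exact: main].
Qed.

Lemma pos_root n (e : R) T : (0 < n)%N -> 0 < e -> adjop_adj T = T -> pos T ->
  exists Z, sbicomm T Z /\ Z ^+ n = rop e + T.
Proof.
move=> n0 e0 Tsa /(pos_shiftD e0) [s [s1 _ hs]].
(* The shift is taken to be [s ^+ n], whose scalar root is [s]. *)
have sn : s <= s ^+ n by rewrite ler_eXnr.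
have {}hs := hs _ sn; set c := s ^+ n in sn hs.
have c0 : 0 < c by lra.
have TX : sbicomm T (rop c^-1 * (rop c - (rop e + T))).
  apply: sbicommM; first exact: sbicomm_rop.
  apply: sbicommB; first exact: sbicomm_rop.
  exact: sbicommD (sbicomm_rop _ _) (sbicomm_refl _).
have [|Z [ZX Zn]] := root_1B n0 TX.1.
  have ci : 0 <= c^-1 by rewrite invr_ge0 ltW.
  by apply: le_lt_trans (opn_ropM_le _ ci) _; rewrite mulrC ltr_pdivrMr // mul1r.
exists (rop s * Z); split.
  by apply: sbicommM (sbicomm_rop _ _) (sbicomm_sub TX ZX).
rewrite exprMn_comm; last exact: ropC.
rewrite -ropX -/c Zn mulrBr mulr1 rop_unitK ?gt_eqF //.
by rewrite subKr.
Qed.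

Lemma pos_inv (e : R) T : 0 < e -> adjop_adj T = T -> pos T ->
  exists Y, [/\ sbicomm T Y, (rop e + T) * Y = 1 & Y * (rop e + T) = 1].
Proof.
move=> e0 Tsa /(pos_shiftD e0) [s [s1 hs _]].
have s0 : 0 < s by lra.
have TX : sbicomm T (rop s^-1 * (rop s - (rop e + T))).
  apply: sbicommM; first exact: sbicomm_rop.
  apply: sbicommB; first exact: sbicomm_rop.
  exact: sbicommD (sbicomm_rop _ _) (sbicomm_refl _).
have [|Y [YX _ Y1]] := @neumann _ _ _ _ _ TX.1 (lexx _).
  have ci : 0 <= s^-1 by rewrite invr_ge0 ltW.
  by apply: le_lt_trans (opn_ropM_le _ ci) _; rewrite mulrC ltr_pdivrMr // mul1r.
have TY : sbicomm T (rop s^-1 * Y) by apply: sbicommM (sbicomm_rop _ _) (sbicomm_sub TX YX).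
have T1 : (rop e + T) * (rop s^-1 * Y) = 1.
  rewrite -[RHS]Y1 ropCA mulrA; congr (_ * _).
  by rewrite [in RHS]mulrBr -ropM mulVf ?gt_eqF // rop1 subKr.
exists (rop s^-1 * Y); split => //; rewrite -[RHS]T1; apply: sbicomm_comm TY _.
exact: sbicommD (sbicomm_rop _ _) (sbicomm_refl _).
Qed.

(** p + i w and p - i w are adjoint to each other, and their products in both orders are [c ^+ 2].
    Both have norm at most [c], and [p] is half their sum. *)
Lemma opn_sqrD p w (c : R) : 0 <= c -> adjop_adj p = p -> adjop_adj w = w ->
  p * w = w * p -> p * p + w * w = rop (c ^+ 2) -> opn p <= c.
Proof.
move=> c0 psa wsa pw pwc.
pose v := p + 'i%C *: w; pose v' := p - 'i%C *: w.
have vv' : adjop_adj v = v' by rewrite /v /v' adjD adjZ psa wsa conjci scaleNr.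
have v'v : adjop_adj v' = v by rewrite -vv' adjK.
have iw2 : ('i%C *: w) * ('i%C *: w) = - (w * w).
  by rewrite -opZAl -opZAr scalerA mulcii scaleN1r.
have ipw : p * ('i%C *: w) = ('i%C *: w) * p by rewrite -opZAl -opZAr pw.
have n1 : opn v <= c.
  apply: opn_isometry => //; rewrite vv' /v' /v; set J := 'i%C *: w in iw2 ipw *.
  have -> : (p - J) * (p + J) = p * p - J * J + (p * J - J * p) by ncring.
  by rewrite ipw iw2 subrr addr0 opprK.
have n2 : opn v' <= c.
  apply: opn_isometry => //; rewrite v'v /v' /v; set J := 'i%C *: w in iw2 ipw *.
  have -> : (p + J) * (p - J) = p * p - J * J - (p * J - J * p) by ncring.
  by rewrite ipw iw2 subrr subr0 opprK.
have -> : p = rop 2^-1 * (v + v').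
  rewrite /v /v' addrACA subrr addr0.
  have -> : p + p = rop 2 * p by rewrite ropD rop1 mulrDl mul1r.
  have half : 2^-1 * 2 = 1 :> R by rewrite mulVf ?pnatr_eq0.
  by rewrite mulrA -ropM half rop1 mul1r.
apply: le_trans (opn_ropM_le _ _) _; first by rewrite invr_ge0.
have := opnD v v'; lra.
Qed.

(** [w] is [c] times a root of 1 - p^2 / c^2; it commutes with [p] because [p] commutes with p^2. *)
Lemma sqrt_complement p (c : R) : 0 < c -> adjop_adj p = p -> opn (p * p) < c ^+ 2 ->
  exists w, [/\ adjop_adj w = w, p * w = w * p & p * p + w * w = rop (c ^+ 2)].
Proof.
move=> c0 psa pc; have c20 : 0 < c ^+ 2 by rewrite exprn_gt0.
have cV : 0 <= (c ^+ 2)^-1 by rewrite invr_ge0 ltW.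
have Xp : sbicomm (p * p) (rop (c ^+ 2)^-1 * (p * p)).
  by apply: sbicommM (sbicomm_rop _ _) (sbicomm_refl _); rewrite adjM psa.
have [|w [wX w2]] := @root_1B _ _ _ 2%N _ isT Xp.1.
  by apply: le_lt_trans (opn_ropM_le _ cV) _; rewrite mulrC ltr_pdivrMr // mul1r.
have wp := sbicomm_sub Xp wX.
exists (rop c * w); split; first by rewrite adjM adj_rop wX.1 ropC.
  by rewrite ropCA -mulrA wp.2 // mulrA.
have -> : rop c * w * (rop c * w) = rop (c ^+ 2) * w ^+ 2.
  by rewrite -mulrA ropCA mulrA -ropM -!expr2.
by rewrite w2 mulrBr mulr1 rop_unitK ?gt_eqF // addrC addrNK.
Qed.

(** With [opnM] this is the C*-identity for self-adjoint operators. It is approached through every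
    [c] above [Num.sqrt m], where a complement [w] exists. *)
Lemma opn_sqr p : adjop_adj p = p -> opn p ^+ 2 <= opn (p * p).
Proof.
move=> psa; set m := opn (p * p); have m0 : 0 <= m := opn_ge0 _.
suff main : opn p <= Num.sqrt m.
  by rewrite -(sqr_sqrtr m0) lerXn2r ?nnegrE ?opn_ge0 ?sqrtr_ge0.
apply/ler_addgt0Pr => e e0; set c := Num.sqrt m + e.
have c0 : 0 < c by rewrite ltr_wpDl ?sqrtr_ge0.
have c2 : m < c ^+ 2 by rewrite -{1}(sqr_sqrtr m0) ltrXn2r ?ltrDl // sqrtr_ge0.
have [w [wsa pw pwc]] := sqrt_complement c0 psa c2.
exact: opn_sqrD (ltW c0) psa wsa pw pwc.
Qed.

(** c^2 - p^2 = w^2 with |w| <= c, so [c ^+ 2] is a shift that witnesses [pos]. *)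
Lemma pos_sqr p : adjop_adj p = p -> pos (p * p).
Proof.
move=> psa; set m := opn (p * p); have m0 : 0 <= m := opn_ge0 _.
pose c := 1 + m; have c0 : 0 < c by rewrite /c; lra.
have c2 : m < c ^+ 2 by rewrite /c; nra.
have [w [wsa pw pwc]] := sqrt_complement c0 psa c2.
have wc : opn w <= c.
  by apply: (opn_sqrD (ltW c0) wsa psa (esym pw)); rewrite [w * w + _]addrC.
exists (c ^+ 2); rewrite -pwc [p * p + _]addrC addrK expr2.
by apply: le_trans (opnM _ _) _; rewrite ler_pM ?opn_ge0.
Qed.

(** For [e > 0] the difference (a + e)^2 - h^2 is the square of [p * q], with [p] and [q] roots of a
    + e - h and a + e + h; so [opn_sqrD] applies with [a + e]. *)
Lemma opn_pos_le h (a : R) : 0 <= a -> adjop_adj h = h ->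
  pos (rop a - h) -> pos (rop a + h) -> opn h <= a.
Proof.
move=> a0 hsa hm hp; apply/ler_addgt0Pr => e e0.
have sm : sbicomm h (rop a - h) := sbicommB (sbicomm_rop _ _) (sbicomm_refl hsa).
have sp : sbicomm h (rop a + h) := sbicommD (sbicomm_rop _ _) (sbicomm_refl hsa).
have [p [ph p2]] := @pos_root 2%N e _ isT e0 sm.1 hm.
have [q [qh q2]] := @pos_root 2%N e _ isT e0 sp.1 hp.
have {}ph := sbicomm_sub sm ph; have {}qh := sbicomm_sub sp qh.
have pq := sbicomm_comm ph qh.
have pqh := sbicommM ph qh.
apply: (@opn_sqrD h (p * q)) => //; first by rewrite addr_ge0 // ltW.
- exact: pqh.1.
- by rewrite pqh.2.
have -> : p * q * (p * q) = p ^+ 2 * q ^+ 2.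
  by rewrite -mulrA (mulrA q) -pq -!mulrA mulrA -!expr2.
have hc : rop (a + e) * h = h * rop (a + e) by rewrite ropC.
rewrite p2 q2 addrA -ropD addrA -ropD [e + a]addrC.
rewrite ropX; set b := rop (a + e) in hc *.
have -> : (b - h) * (b + h) = b * b - h * h by rewrite mulrBl !mulrDr hc opprD addrA addrK.
by rewrite addrC addrNK expr2.
Qed.

(** The sum is twice the sum of the squares of the real and imaginary parts of [D]. *)
Lemma pos_adjMD D : pos (adjop_adj D * D + D * adjop_adj D).
Proof.
set D' := adjop_adj D.
have usa : adjop_adj (D + D') = D + D' by rewrite adjD adjK addrC.
have vsa : adjop_adj ('i%C *: (D' - D)) = 'i%C *: (D' - D).
  by rewrite adjZ adjB adjK conjci scaleNr -scalerN opprB.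
have -> : D' * D + D * D' = rop 2^-1 * ((D + D') * (D + D')
    + ('i%C *: (D' - D)) * ('i%C *: (D' - D))).
  rewrite -opZAl -opZAr scalerA mulcii scaleN1r.
  have -> : (D + D') * (D + D') - (D' - D) * (D' - D) = (1 + 1) * (D' * D + D * D') by ncring.
  by rewrite mulrA -rop1 -ropD -ropM mulVf ?rop1 ?mul1r // gt_eqF.
by apply: posZ; [rewrite invr_ge0 | apply: posD; exact: pos_sqr].
Qed.

(** Raising [n] by one adds T^2 (1 - T)^n, the square of [T * s ^+ n] where s^2 = 1 - T. *)
Lemma pos_1BM T n : adjop_adj T = T -> opn T < 1 -> pos (1 - T * (1 - T) ^+ n).
Proof.
move=> Tsa T1; have [s [sT s2]] := @root_1B _ _ _ 2%N T isT Tsa T1.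
elim: n => [|n IH]; first by rewrite expr0 mulr1 -s2 expr2; exact/pos_sqr/sT.1.
have TT : sbicomm T T := sbicomm_refl Tsa.
have sn := sbicommX n sT.
have -> : 1 - T * (1 - T) ^+ n.+1
    = 1 - T * (1 - T) ^+ n + (T * s ^+ n) * (T * s ^+ n).
  rewrite {2}(sbicomm_comm TT sn) exprSr.
  have -> : (1 - T) ^+ n = s ^+ n * s ^+ n by rewrite -s2 -exprM mul2n -addnn exprD.
  ncring.
by apply: posD => //; apply: pos_sqr; exact: (sbicommM TT sn).1.
Qed.

Lemma adjM_selfadj D : adjop_adj (adjop_adj D * D) = adjop_adj D * D.
Proof. by rewrite adjM adjK. Qed.

Lemma mulr_1BX S T n : S * (1 - T * S) ^+ n = (1 - S * T) ^+ n * S.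
Proof.
elim: n => [|n IH]; first by rewrite !expr0 mulr1 mul1r.
by rewrite exprSr mulrA IH exprSr -!mulrA; congr (_ * _); ncring.
Qed.

(* With h = D^* D, k = D D^* and 1 - h = s^2, the operator c = D s^n satisfies
   c^* c = h (1 - h)^n and c c^* = k (1 - k)^n <= 1, while c^* c + c c^* >= 0. *)
Lemma opn_adjM_1BX_le D n : opn (adjop_adj D * D) < 1 -> opn (D * adjop_adj D) < 1 ->
  opn (adjop_adj D * D * (1 - adjop_adj D * D) ^+ n) <= 1.
Proof.
set D' := adjop_adj D; set h := D' * D; set k := D * D' => h1 k1.
have hsa : adjop_adj h = h := adjM_selfadj D.
have ksa : adjop_adj k = k by rewrite adjM adjK.
have [s [sh s2]] := @root_1B _ _ _ 2%N h isT hsa h1.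
have sn := sbicommX n sh.
have yE : (1 - h) ^+ n = s ^+ n * s ^+ n by rewrite -s2 -exprM mul2n -addnn exprD.
have hh : sbicomm h h := sbicomm_refl hsa.
have hy : sbicomm h (h * (1 - h) ^+ n).
  by apply: sbicommM hh (sbicommX _ (sbicommB (sbicomm1 _) hh)).
have c1 : adjop_adj (D * s ^+ n) * (D * s ^+ n) = h * (1 - h) ^+ n.
  by rewrite yE [RHS]mulrA (sbicomm_comm hh sn) adjM sn.1 -/D' /h !mulrA.
have c2 : (D * s ^+ n) * adjop_adj (D * s ^+ n) = k * (1 - k) ^+ n.
  rewrite adjM sn.1 -/D' -mulrA (mulrA (s ^+ n)) -yE mulrA mulr_1BX -/k -mulrA.
  have kk : sbicomm k k := sbicomm_refl ksa.
  exact: sbicomm_comm (sbicommX _ (sbicommB (sbicomm1 _) kk)) kk.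
have := pos_adjMD (D * s ^+ n); rewrite c1 c2 => sum_pos.
apply: opn_pos_le => //; first exact: hy.1.
  by rewrite rop1; exact: pos_1BM.
have -> : rop 1 + h * (1 - h) ^+ n
    = (1 - k * (1 - k) ^+ n) + (h * (1 - h) ^+ n + k * (1 - k) ^+ n).
  by rewrite rop1; ncring.
by apply: posD => //; exact: pos_1BM.
Qed.

(** Iterates [opn_sqr], which is why the exponents are powers of two. *)
Lemma opnX2 p j : adjop_adj p = p -> opn p ^+ (2 ^ j) <= opn (p ^+ (2 ^ j)).
Proof.
elim: j p => [|j IH] p psa; first by rewrite expn0 !expr1.
rewrite expnS !exprM; apply: le_trans (_ : opn (p ^+ 2) ^+ (2 ^ j) <= _).
  by rewrite lerXn2r ?nnegrE ?exprn_ge0 ?opn_ge0 // expr2 opn_sqr.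
by apply: IH; rewrite adjX psa.
Qed.

(** If [N > 1] then, for m + 1 a power of two, N^(m+1) <= |y^m - h y^m| <= N^m + 1. So N^m (N - 1)
    <= 1, which fails for large [m]. *)
Lemma opn_1B_adjM_le D : opn (adjop_adj D * D) < 1 -> opn (D * adjop_adj D) < 1 ->
  opn (1 - adjop_adj D * D) <= 1.
Proof.
move=> h1 k1; have bnd n := opn_adjM_1BX_le n h1 k1.
set h := adjop_adj D * D in h1 bnd *; set y := 1 - h.
have ysa : adjop_adj y = y by rewrite adjB adj1 adjM_selfadj.
set N := opn y; rewrite leNgt; apply/negP => N1.
have N0 : 0 < N by lra.
have [||n hn] := @geometric_lt _ N^-1 (N - 1).
- by rewrite invr_ge0 ltW //= invf_lt1.
- by rewrite subr_gt0.
have [m hm] : exists m, (2 ^ n = m.+1)%N by exists (2 ^ n).-1; rewrite prednK // expn_gt0.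
have nm : (n <= m)%N by rewrite -ltnS -hm ltn_expl.
have e1 : N ^+ m.+1 <= N ^+ m + 1.
  rewrite -hm; apply: le_trans (opnX2 n ysa) _; rewrite hm.
  have -> : y ^+ m.+1 = y ^+ m - h * y ^+ m by rewrite exprS mulrBl mul1r.
  by apply: le_trans (opnB _ _) (lerD (opnX_le _ (lexx _)) (bnd m)).
have e2 : N ^+ n <= N ^+ m by rewrite ler_weXn2l // ltW.
have Nn : 0 < N ^+ n by rewrite exprn_gt0.
have e3 : 1 < N ^+ n * (N - 1).
  by move: hn; rewrite exprVn -[_^-1]mul1r ltr_pdivrMr // mulrC.
rewrite exprS in e1; nra.
Qed.

(* Kaplansky's theorem for L(H). *)
Theorem pos_adjM D : pos (adjop_adj D * D).
Proof.
(* [M] is at least 1 and exceeds both norms, so scaling [D] by [M^-1] brings both products below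
   norm 1. *)
pose M := 1 + opn (adjop_adj D * D) + opn (D * adjop_adj D).
have hM := opn_ge0 (adjop_adj D * D); have kM := opn_ge0 (D * adjop_adj D).
have M0 : 0 < M by rewrite /M; lra.
pose c := M^-1; have c0 : 0 < c by rewrite invr_gt0.
have sM : c * c * (M * M) = 1 by rewrite /c; field; rewrite gt_eqF.
have small T : opn T < M -> opn (rop (c * c) * T) < 1.
  move=> TM; apply: le_lt_trans (opn_ropM_le _ _) _; first by rewrite mulr_ge0 // ltW.
  have : 0 < c * c by rewrite mulr_gt0.
  have : opn T < M * M by rewrite /M in TM *; nra.
  nra.
have cD : adjop_adj (rop c * D) = rop c * adjop_adj D by rewrite adjM adj_rop ropC.
have ropMM S T : rop c * S * (rop c * T) = rop (c * c) * (S * T).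
  by rewrite ropM -!mulrA; congr (_ * _); rewrite ropCA.
have e1 : adjop_adj (rop c * D) * (rop c * D) = rop (c * c) * (adjop_adj D * D).
  by rewrite cD ropMM.
have e2 : (rop c * D) * adjop_adj (rop c * D) = rop (c * c) * (D * adjop_adj D).
  by rewrite cD ropMM.
have := @opn_1B_adjM_le (rop c * D); rewrite e1 e2 => /(_ (small _ _) (small _ _)) h.
have cc : 0 < c * c by rewrite mulr_gt0.
have cV : 0 <= (c * c)^-1 by rewrite invr_ge0 ltW.
exists (c * c)^-1.
have -> : rop (c * c)^-1 - adjop_adj D * D
    = rop (c * c)^-1 * (1 - rop (c * c) * (adjop_adj D * D)).
  by rewrite mulrBr mulr1 [rop (c * c)^-1 * (rop _ * _)]mulrA -ropM mulVf ?gt_eqF // rop1 mul1r.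
apply: le_trans (opn_ropM_le _ cV) _; rewrite ler_piMr //; apply: h; rewrite /M; lra.
Qed.

End Positivity.

(** * Idempotents *)

Section SelfAdjoint.
Context {R : realType} {A : cstarAlgType R} {H : hilbertModType A}.
Implicit Types (S T X C : adjop H H).

Lemma selfadj_sqr_eq0 S X : adjop_adj S = S -> S * (S * X) = 0 -> S * X = 0.
Proof.
move=> Ssa SSX; apply: adjop_ext => x; apply: (@inner_eq0 R A H).
by rewrite -{1}Ssa opME adjPC -!opME SSX inner0r.
Qed.

Lemma selfadj_exp_eq0 S X n : adjop_adj S = S -> S ^+ n.+1 * X = 0 -> S * X = 0.
Proof.
move=> Ssa; elim: n => [|n IH]; first by rewrite expr1.
move=> h; apply: IH; rewrite exprS -mulrA; apply: selfadj_sqr_eq0 => //.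
by move: h; rewrite !exprS -!mulrA.
Qed.

Lemma op_expE S n x : (S ^+ n) x = iter n S x.
Proof. by elim: n => [|n IH] //; rewrite exprS opME IH. Qed.

Lemma op_positiveP (T : H -> H) :
  op_positive T <-> exists C, T = adjop_adj C * C :> (H -> H).
Proof.
split=> [[C hC ->]|[C ->]]; first by exists (Adjop hC).
by exists C; [exact: adjopP|].
Qed.

(** [op_root] chooses some positive root once one exists. Later arguments either prove uniqueness or
    work for whichever root is chosen. *)
Lemma op_rootP n (T : H -> H) S C : S = adjop_adj C * C -> S ^+ n = T :> (H -> H) ->
  exists S' C', [/\ op_root n T = S' :> (H -> H), S' = adjop_adj C' * C'
    & S' ^+ n = T :> (H -> H)].
Proof.
move=> SC ST; have [|/op_positiveP[C' hC'] hT] :=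
  @xgetPex _ (fun=> 0) [set S | op_positive S /\ iter n S = T].
  exists (adjop_fun S); split; first by apply/op_positiveP; exists C; rewrite SC.
  by apply/funext => x; rewrite -ST op_expE.
exists (adjop_adj C' * C'), C'; split => //.
by apply/funext => x; rewrite op_expE -hT -hC'.
Qed.

End SelfAdjoint.

Section Idempotent.
Context {R : realType} {A : cstarAlgType R} {H : hilbertModType A}.
Implicit Types (S T X C Z : adjop H H).

(* The data shared by an idempotent q and its adjoint q': K = (q + q' - 1)^2,
   r = K^(1/2), rho = r^(1/2) and the inverses r' and rho'. *)
Record idem_data (q q' K r r' rho rho' : adjop H H) : Prop := IdemData {
  id_idem : q * q = q;
  id_adj : adjop_adj q = q';
  id_K : K = (q + q' - 1) * (q + q' - 1);
  id_r : rho * rho = r;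
  id_r' : rho' * rho' = r';
  id_rr : r * r = K;
  id_rhoK : rho * rho' = 1;
  id_rhoVK : rho' * rho = 1;
  id_rho_sa : adjop_adj rho = rho;
  id_rhoC : forall Z, Z * K = K * Z -> Z * rho = rho * Z
}.

Lemma idem_data_ex (q : adjop H H) : q * q = q ->
  exists K r r' rho rho', idem_data q (adjop_adj q) K r r' rho rho'.
Proof.
move=> qq; set q' := adjop_adj q.
have q'q' : q' * q' = q' by rewrite -adjM qq.
pose Z := 'i%C *: (q - q').
have Zsa : adjop_adj Z = Z by rewrite adjZ adjB adjK -/q' conjci scaleNr -scalerN opprB.
have G2 : (q + q' - 1) * (q + q' - 1) = rop 1 + Z * Z.
  rewrite /Z -opZAl -opZAr scalerA mulcii scaleN1r rop1.
  have -> : (q + q' - 1) * (q + q' - 1)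
      = 1 + (q * q + q' * q' - q - q') * (1 + 1) - (q - q') * (q - q') by ncring.
  have z : q + q' - q - q' = 0 by rewrite addrAC addrK subrr.
  by rewrite qq q'q' z mul0r addr0.
have Zpos := pos_sqr Zsa.
have ZZsa : adjop_adj (Z * Z) = Z * Z by rewrite adjM Zsa.
(* A fourth root of K = 1 + Z^2, so that r = rho^2 is visibly of the form C^* C; the inverse of
   [rho] is then rho^3 K^-1. *)
have [rho [rZ r4]] := @pos_root _ _ _ 4%N 1 _ isT ltr01 ZZsa Zpos.
have [Y [YZ Y1 Y2]] := @pos_inv _ _ _ 1 _ ltr01 ZZsa Zpos.
have rY := sbicomm_comm rZ YZ.
have rhoK : rho * (rho ^+ 3 * Y) = 1 by rewrite mulrA -exprS r4.
exists ((q + q' - 1) * (q + q' - 1)), (rho * rho).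
exists (rho ^+ 3 * Y * (rho ^+ 3 * Y)), rho, (rho ^+ 3 * Y).
split => //.
- by rewrite G2 -r4 -!expr2 -exprM.
- by rewrite -[RHS]rhoK; apply/esym/(sbicomm_comm rZ (sbicommM (sbicommX _ rZ) YZ)).
- exact: rZ.1.
- move=> X; rewrite G2 rop1 mulrDr mulrDl mulr1 mul1r => /addrI XZ.
  exact: rZ.2.
Qed.

Lemma idem_data_sym (q q' K r r' rho rho' : adjop H H) :
  idem_data q q' K r r' rho rho' -> idem_data q' q K r r' rho rho'.
Proof.
case=> qq qa KE h1 h2 h3 h4 h5 h6 h7; split => //.
- by rewrite -qa -adjM qq.
- by rewrite -qa adjK.
- by rewrite (addrC q').
Qed.

Section Data.
Variables (q q' K r r' rho rho' P : adjop H H).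
Hypothesis qd : idem_data q q' K r r' rho rho'.
Hypothesis PE : P = r' * r' * (q * q').

Let qq : q * q = q := id_idem qd.
Let adjq : adjop_adj q = q' := id_adj qd.
Let adjq' : adjop_adj q' = q. Proof. by rewrite -adjq adjK. Qed.
Let q'q' : q' * q' = q'. Proof. by rewrite -adjq -adjM qq. Qed.
Let KE := id_K qd.

(** The intermediate expression displays the terms that cancel by idempotence, a rule outside the
    reach of [ncring]. *)
Let qK : q * K = q * q' * q.
Proof.
have -> : q * K = q * q' * q + q * q * (q - 1) + q * q * q' - q * q'
    - (q * q - q) + q * (q' * q' - q').
  rewrite KE; ncring.
by rewrite qq q'q' mulrBr qq mulr1 !subrr mulr0 !(addr0, subr0) addrK.
Qed.

Let Kq : K * q = q * q' * q.
Proof.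
have -> : K * q = q * q' * q + (q - 1) * (q * q) + q' * (q * q) - q' * q
    - (q * q - q) + (q' * q' - q') * q.
  rewrite KE; ncring.
by rewrite qq q'q' mulrBl qq mul1r !subrr mul0r !(addr0, subr0) addrK.
Qed.

Lemma idem_comm : q * K = K * q. Proof. by rewrite qK Kq. Qed.

Let q'K : q' * K = K * q'.
Proof.
have K_sa : adjop_adj K = K by rewrite KE adjM adjB adjD adj1 adjq adjq' [q' + q]addrC.
by rewrite -{1}K_sa -adjq -adjM -idem_comm adjM K_sa.
Qed.

Lemma idem_rhoVC Z : Z * rho = rho * Z -> Z * rho' = rho' * Z.
Proof.
move=> Zr; rewrite -[LHS]mul1r -(id_rhoVK qd) -!mulrA; congr (_ * _).
by rewrite mulrA -Zr -mulrA (id_rhoK qd) mulr1.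
Qed.

Lemma idem_rC Z : Z * rho = rho * Z -> Z * r = r * Z.
Proof. by move=> h; rewrite -(id_r qd) mulrA h -mulrA h mulrA. Qed.

Lemma idem_rVC Z : Z * rho = rho * Z -> Z * r' = r' * Z.
Proof. by move=> /idem_rhoVC h; rewrite -(id_r' qd) mulrA h -mulrA h mulrA. Qed.

Let rhoq : q * rho = rho * q := id_rhoC qd idem_comm.
Let rhoq' : q' * rho = rho * q' := id_rhoC qd q'K.

Lemma idem_rK : r * r' = 1.
Proof.
by rewrite -(id_r qd) -(id_r' qd) mulrA -(mulrA rho) (id_rhoK qd) mulr1 (id_rhoK qd).
Qed.

Lemma idem_rVK : r' * r = 1.
Proof.
by rewrite -(id_r qd) -(id_r' qd) mulrA -(mulrA rho') (id_rhoVK qd) mulr1 (id_rhoVK qd).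
Qed.

Lemma idem_rhoV_sa : adjop_adj rho' = rho'.
Proof.
have e : adjop_adj rho' * rho = 1.
  by rewrite -[in X in _ * X](id_rho_sa qd) -adjM (id_rhoK qd) adj1.
by rewrite -[LHS]mulr1 -(id_rhoK qd) mulrA e mul1r.
Qed.

Lemma idem_r_sa : adjop_adj r = r.
Proof. by rewrite -(id_r qd) adjM (id_rho_sa qd). Qed.

Lemma idem_rV_sa : adjop_adj r' = r'.
Proof. by rewrite -(id_r' qd) adjM idem_rhoV_sa. Qed.

Lemma rprojE : K * P = q * q'.
Proof. by rewrite PE mulrA -(id_rr qd) -(mulrA r) (mulrA r r') idem_rK mul1r idem_rK mul1r. Qed.

Let r'rho : rho * r' = r' * rho. Proof. exact: idem_rVC. Qed.

Let qq'rho : q * q' * rho = rho * (q * q').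
Proof. by rewrite -mulrA rhoq' mulrA rhoq mulrA. Qed.

Lemma rproj_rhoC : P * rho = rho * P.
Proof.
rewrite PE -mulrA qq'rho mulrA [RHS]mulrA; congr (_ * _).
by rewrite -mulrA -r'rho mulrA -r'rho mulrA.
Qed.

Lemma rproj_rC : P * r = r * P. Proof. exact/idem_rC/rproj_rhoC. Qed.
Lemma rproj_rVC : P * r' = r' * P. Proof. exact/idem_rVC/rproj_rhoC. Qed.
Lemma rproj_KC : P * K = K * P.
Proof. by rewrite -(id_rr qd) mulrA rproj_rC -mulrA rproj_rC mulrA. Qed.

Let r'r'K : r' * r' * K = 1.
Proof. by rewrite -(id_rr qd) mulrA -(mulrA r') idem_rVK mulr1 idem_rVK. Qed.

(** [P * q] is K^-1 q q' q, and q q' q = K q. *)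
Lemma rproj_idem : P * q = q.
Proof. by rewrite PE -mulrA -qK idem_comm mulrA r'r'K mul1r. Qed.

Lemma rproj_sa : adjop_adj P = P.
Proof.
have c : q * q' * r' = r' * (q * q') by exact/idem_rVC/qq'rho.
by rewrite PE !adjM idem_rV_sa adjq adjq' mulrA c -mulrA c mulrA.
Qed.

Lemma idem_rproj : q * P = P.
Proof.
have c : q * r' = r' * q := idem_rVC rhoq.
by rewrite PE mulrA (mulrA q r') c -(mulrA r' q) c -!mulrA (mulrA q q) qq.
Qed.

Lemma rproj_factor : P = q * (q' * (r' * r')).
Proof.
have c : q * q' * r' = r' * (q * q') by exact/idem_rVC/qq'rho.
by rewrite PE [RHS]mulrA [RHS]mulrA c -[RHS]mulrA c [RHS]mulrA.
Qed.

Lemma rprojP : P * P = P.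
Proof. by rewrite {2}rproj_factor mulrA rproj_idem -rproj_factor. Qed.

Let Pq' : P * q' = P.
Proof. by rewrite -rproj_sa -adjq -adjM idem_rproj. Qed.

Let q'P : q' * P = q'.
Proof. by rewrite -rproj_sa -adjq -adjM rproj_idem. Qed.

Lemma abs_adj_ex : r * P = adjop_adj (rho * P) * (rho * P) /\ (r * P) * (r * P) = q * q'.
Proof.
have Pr := rproj_rC; split.
  rewrite adjM (id_rho_sa qd) rproj_sa mulrA -(mulrA P) (id_r qd) Pr.
  by rewrite -mulrA rprojP.
by rewrite mulrA -(mulrA r) Pr mulrA (id_rr qd) -mulrA rprojP rprojE.
Qed.

(* Uniqueness of the positive square root of q q': a root S commutes with K,
   so (S - r P)(S + r) = 0, and S + r is invertible by Kaplansky's theorem. *)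
Lemma abs_adj_uniq (S C : adjop H H) :
  S = adjop_adj C * C -> S * S = q * q' -> S = r * P.
Proof.
move=> SC SS; have Ssa : adjop_adj S = S by rewrite SC adjM_selfadj.
have SP : S * P = S.
  apply/eqP; rewrite eq_sym -subr_eq0; apply/eqP.
  have -> : S - S * P = S * (1 - P) by rewrite mulrBr mulr1.
  apply: selfadj_sqr_eq0 => //; rewrite mulrA SS -rprojE -mulrA mulrBr mulr1.
  by rewrite rprojP subrr mulr0.
have PS : P * S = S by rewrite -{1}Ssa -{1}rproj_sa -adjM SP.
(* Since K P = q q' = S^2, both sides are S^3. *)
have SK : S * K = K * S.
  have -> : K * S = S * S * S by rewrite -{1}PS mulrA rprojE SS.
  by rewrite -{1}SP -mulrA rproj_KC rprojE -SS mulrA.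
have Srho := id_rhoC qd SK.
have Sr := idem_rC Srho.
have [Y [_ Y1 _]] := pos_inv ltr01 (adjM_selfadj (C * rho')) (pos_adjM (C * rho')).
rewrite rop1 in Y1; set E := adjop_adj (C * rho') * (C * rho') in Y1.
(* [E] is positive, so [1 + E] has the inverse [Y]; with [rho] invertible, [S + r] is invertible
   too. *)
have Sr_factor : S + r = rho * (1 + E) * rho.
  have -> : rho * (1 + E) * rho = rho * rho + rho * rho' * (adjop_adj C * C) * (rho' * rho).
    by rewrite /E adjM idem_rhoV_sa mulrDr mulrDl mulr1 !mulrA.
  by rewrite (id_rhoK qd) (id_rhoVK qd) mul1r mulr1 -SC (id_r qd) addrC.
have zero : (S - r * P) * (S + r) = 0.
  have -> : (S - r * P) * (S + r) = S * S + S * r - r * (P * S) - r * (P * r) by ncring.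
  by rewrite PS rproj_rC (mulrA r r) (id_rr qd) rprojE SS Sr addrK subrr.
apply/eqP; rewrite -subr_eq0; apply/eqP.
have : (S - r * P) * (S + r) * (rho' * Y * rho') = 0 by rewrite zero mul0r.
have -> : (S - r * P) * (S + r) * (rho' * Y * rho')
    = (S - r * P) * (rho * ((1 + E) * (rho * rho' * Y)) * rho').
  by rewrite Sr_factor !mulrA.
by rewrite (id_rhoK qd) mul1r Y1 mulr1 (id_rhoK qd) mulr1.
Qed.

End Data.

(** * Algebraic identities for the matched projection *)

Section Matched.
Variables (q q' K r r' rho rho' P P1 N : adjop H H).
Hypothesis qd : idem_data q q' K r r' rho rho'.
Hypothesis PE : P = r' * r' * (q * q').
Hypothesis P1E : P1 = r' * r' * (q' * q).
Hypothesis N1 : N * (1 + r) = 1.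
Hypothesis NC : forall Z, Z * r = r * Z -> Z * N = N * Z.

Variables (X X' M : adjop H H).
Hypothesis XE : X = r * P + q.
Hypothesis X'E : X' = r * P + q'.
Hypothesis ME : M = rop 2^-1 * (r' * N * (X' * X)).
(** [d] is the inverse of [s], and [c] is half of [d], so that M = c X' X. *)
Variables (c d s : adjop H H).
Hypothesis dE : d = r' * N.
Hypothesis cE : c = rop 2^-1 * d.
Hypothesis sE : s = r * (1 + r).

Let adjq : adjop_adj q = q' := id_adj qd.
Let Pq : P * q = q := rproj_idem qd PE.
Let qP : q * P = P := idem_rproj qd PE.
Let P_sa : adjop_adj P = P := rproj_sa qd PE.
Let PP : P * P = P := rprojP qd PE.
Let Pr : P * r = r * P := rproj_rC qd PE.
Let Pq' : P * q' = P. Proof. by rewrite -P_sa -adjq -adjM qP. Qed.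
Let q'P : q' * P = q'. Proof. by rewrite -P_sa -adjq -adjM Pq. Qed.
Let KP : K * P = q * q' := rprojE qd PE.
Let KP1 : K * P1 = q' * q := rprojE (idem_data_sym qd) P1E.
Let rr : r * r = K := id_rr qd.
Let qr : q * r = r * q. Proof. exact/(idem_rC qd)/(id_rhoC qd)/(idem_comm qd). Qed.
Let q'r : q' * r = r * q'.
Proof. exact/(idem_rC qd)/(id_rhoC qd)/(idem_comm (idem_data_sym qd)). Qed.
Let half2 : 2^-1 * 2 = 1 :> R. Proof. by rewrite mulVf ?pnatr_eq0. Qed.

Lemma idem_commVr Z : Z * r = r * Z -> Z * r' = r' * Z.
Proof.
move=> Zr; rewrite -[LHS]mul1r -(idem_rVK qd) -!mulrA; congr (_ * _).
by rewrite mulrA -Zr -mulrA (idem_rK qd) mulr1.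
Qed.

Let r'N : r' * N = N * r'.
Proof. by apply: NC; rewrite (idem_rVK qd) (idem_rK qd). Qed.

Let Xr : X * r = r * X.
Proof. by rewrite XE mulrDl mulrDr -mulrA Pr qr. Qed.
Let X'r : X' * r = r * X'.
Proof. by rewrite X'E mulrDl mulrDr -mulrA Pr q'r. Qed.

Let comm_d Z : Z * r = r * Z -> Z * d = d * Z.
Proof. by move=> Zr; rewrite dE mulrA idem_commVr // -mulrA NC // mulrA. Qed.

Let d_r1 : d * (1 + r) = r'. Proof. by rewrite dE -mulrA N1 mulr1. Qed.
Let d_s : d * s = 1.
Proof.
rewrite sE mulrA -comm_d // -mulrA d_r1; exact: idem_rK qd.
Qed.

(** Gives idempotence: M M = c^2 X' (X X') X reduces to c X' X because c (s + s) = 1 and P X = X.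
    [XqX'] plays the same part for M q M. *)
Let XX' : X * X' = (s + s) * P.
Proof.
rewrite sE XE X'E.
have -> : (r * P + q) * (r * P + q')
    = r * (P * r) * P + r * (P * q') + q * r * P + q * q' by ncring.
rewrite Pr Pq' qr -!mulrA qP PP -KP -rr; ncring.
Qed.

Let PX : P * X = X.
Proof. by rewrite XE mulrDr Pq mulrA Pr -mulrA PP. Qed.

Let XqX' : X * q * X' = s * (1 + r) * P.
Proof.
rewrite sE.
have -> : X * q = (1 + r) * q by rewrite XE mulrDl -mulrA Pq (id_idem qd) mulrDl mul1r addrC.
rewrite X'E -mulrA mulrDr mulrA qr -mulrA qP -KP -rr; ncring.
Qed.

Lemma matched_op_sa : adjop_adj M = M.
Proof.
have X'X : adjop_adj X = X'.
  by rewrite XE X'E adjD adjM P_sa (idem_r_sa qd) Pr adjq.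
have r'sa : adjop_adj r' = r' := idem_rV_sa qd.
have Nsa : adjop_adj N = N.
  have h : (1 + r) * adjop_adj N = 1.
    by rewrite -{1}(idem_r_sa qd) -adj1 -adjD -adjM N1 adj1.
  by rewrite -[LHS]mul1r -N1 -mulrA h mulr1.
have dsa : adjop_adj d = d by rewrite dE adjM r'sa Nsa r'N.
have e : adjop_adj (X' * X) = X' * X by rewrite -X'X adjM adjK.
rewrite ME -dE adjM adj_rop -ropC; congr (_ * _); rewrite adjM dsa e.
apply: comm_d; by rewrite -mulrA Xr mulrA X'r mulrA.
Qed.

Let comm_c Z : Z * r = r * Z -> Z * c = c * Z.
Proof. by move=> Zr; rewrite cE ropCA comm_d // mulrA. Qed.

Let ME' : M = c * (X' * X). Proof. by rewrite ME cE dE mulrA. Qed.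

Let comm_s Z : Z * r = r * Z -> Z * s = s * Z.
Proof.
by move=> Zr; rewrite sE mulrA Zr -!mulrA mulrDr mulrDl Zr mulr1 mul1r.
Qed.

Let cs : c * s = rop 2^-1.
Proof. by rewrite cE -mulrA d_s mulr1. Qed.

Lemma matched_op_idem : M * M = M.
Proof.
have cu : c * (s + s) = 1.
  by rewrite mulrDr cs -ropD (_ : 2^-1 + 2^-1 = 1) ?rop1 //; field.
have cX : X' * X * c = c * (X' * X).
  by apply: comm_c; rewrite -mulrA Xr mulrA X'r mulrA.
rewrite ME' mulrA -(mulrA c (X' * X)) cX.
have -> : c * (c * (X' * X)) * (X' * X) = c * c * (X' * (X * X') * X) by rewrite -!mulrA.
rewrite XX'; have uX : X' * (s + s) = (s + s) * X'.
  by rewrite mulrDr mulrDl (comm_s X'r).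
move: (s + s) cu uX => u cu uX.
have -> : X' * (u * P) * X = u * (X' * (P * X)) by rewrite !mulrA uX.
by rewrite PX mulrA -(mulrA c) cu mulr1.
Qed.

Lemma matched_op_compress : M * q * M = rop 2^-1 * ((1 + r) * M).
Proof.
have cXq : X' * X * q * c = c * (X' * X * q).
  apply: comm_c; rewrite -mulrA qr mulrA -[X' * X * r]mulrA Xr (mulrA X') X'r.
  by rewrite !mulrA.
rewrite ME' mulrA -(mulrA c (X' * X)) -(mulrA c _ c) cXq.
have -> : c * (c * (X' * X * q)) * (X' * X) = c * c * (X' * (X * q * X') * X) by rewrite -!mulrA.
rewrite XqX'.
have -> : X' * (s * (1 + r) * P) * X = s * ((1 + r) * (X' * (P * X))).
  have X't : X' * (1 + r) = (1 + r) * X' by rewrite mulrDr mulrDl X'r mulr1 mul1r.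
  by rewrite !mulrA (comm_s X'r) -[s * X' * (1 + r)]mulrA X't -!mulrA.
rewrite PX mulrA -(mulrA c c) cs -ropC -[LHS]mulrA; congr (_ * _).
rewrite mulrA [RHS]mulrA; congr (_ * _).
by rewrite comm_c // mulrDr mulrDl mulr1 mul1r.
Qed.

Lemma matched_op_comm : M * r = r * M.
Proof.
have e : X' * X * r = r * (X' * X) by rewrite -mulrA Xr mulrA X'r mulrA.
have dr : d * r = r * d by rewrite comm_d.
by rewrite ME -dE -mulrA -(mulrA d) e (mulrA d) dr -(mulrA r) ropCA.
Qed.

Lemma matched_op_sum : r * P + r * P1 + q + q' = rop 2 * ((1 + r) * M).
Proof.
have rc : (1 + r) * c = c * (1 + r) by apply: comm_c; rewrite mulrDl mulrDr mulr1 mul1r.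
have -> : rop 2 * ((1 + r) * M) = r' * (X' * X).
  rewrite ME' (mulrA (1 + r)) rc cE -!mulrA (mulrA d) d_r1.
  by rewrite mulrA -ropM mulfV ?pnatr_eq0 // rop1 mul1r.
have -> : X' * X = r * (r * P + r * P1 + q + q').
  rewrite X'E XE.
  have -> : (r * P + q') * (r * P + q) = r * (P * r) * P + r * (P * q) + q' * r * P + q' * q.
    by ncring.
  rewrite Pr Pq q'r -(mulrA r q') q'P -KP1 -rr -!mulrA PP; ncring.
by rewrite mulrA (idem_rVK qd) mul1r.
Qed.

(** The four summands are the entries of the block matrix, extended to H: [q - P] stands for A,
    [q' - P] for A^*, [r] for B and [N] for the inverse of B + 1. *)
Lemma matched_op_block : M = rop 2^-1 * (r' * (1 + r) * P + r' * (q - P) + (q' - P) * r'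
  + (q' - P) * (r' * N * (q - P))).
Proof.
rewrite ME; congr (_ * _); rewrite -dE.
have -> : X = (1 + r) * P + (q - P) by rewrite XE; ncring.
have -> : X' = (1 + r) * P + (q' - P) by rewrite X'E; ncring.
set V := q - P; set W := q' - P; set t := 1 + r.
have PV : P * V = V by rewrite /V mulrBr Pq PP.
have WP : W * P = W by rewrite /W mulrBl q'P PP.
have Pt : P * t = t * P by rewrite /t mulrDr mulrDl Pr mulr1 mul1r.
have Wr : W * r = r * W by rewrite /W mulrBl mulrBr q'r Pr.
have Wt : W * t = t * W by rewrite /t [LHS]mulrDr [RHS]mulrDl Wr mulr1 mul1r.
have Wd := comm_d Wr; have Wr' := idem_commVr Wr; have dt : d * t = r' := d_r1.
clearbody V W t.
have -> : (t * P + W) * (t * P + V) = t * (P * t) * P + t * (P * V) + W * t * P + W * V.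
  by ncring.
rewrite Pt PV Wt -!mulrA WP PP !mulrDr !(mulrA d t) dt.
by rewrite (mulrA d W) -Wd -Wr' -!mulrA.
Qed.

(** Covers the case of a projection, where the matched projection is defined to be [Q]. *)
Lemma matched_op_self : q = q' -> r = 1 -> M = q.
Proof.
move=> qq' r1; have r'1 : r' = 1 by rewrite -(idem_rK qd) r1 mul1r.
have P1' : P = q by rewrite PE r'1 -qq' (id_idem qd) !mul1r.
have N2 : N * rop 2 = 1 by rewrite -N1 r1 (_ : rop 2 = 1 + 1) // ropD rop1.
have XX : X' * X = rop 2 * (rop 2 * q).
  rewrite X'E XE -qq' P1' r1 mul1r mulrDl mulrDr (id_idem qd) (_ : rop 2 = 1 + 1) ?ropD ?rop1 //.
  ncring.
by rewrite ME XX r'1 mul1r (mulrA N) N2 mul1r mulrA -ropM half2 rop1 mul1r.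
Qed.

End Matched.
End Idempotent.

(** * The matched projection *)

Section Submodules.
Context {R : realType} {A : cstarAlgType R} {H : hilbertModType A}.

Lemma adjop_subr (T : adjop H H) x y : T (x - y) = T x - T y.
Proof. exact: linearB. Qed.

Lemma range_subset_op (S T Z : adjop H H) : S = T * Z -> range S `<=` range T.
Proof. by move=> -> _ [x _ <-]; exists (Z x). Qed.

Lemma submod_inner_injr (p : submodClosed H) (u v : submod p) :
  (forall z, inner z u = inner z v :> A) -> u = v.
Proof.
move=> uv; apply/val_inj/eqP; rewrite -subr_eq0; apply/eqP/(@inner_eq0 R A H).
have -> : \val u - \val v = \val (u - v) by rewrite raddfB.
rewrite [X in inner _ X]raddfB innerBr.
by rewrite [inner (val (u - v)) (val u)]uv subrr.
Qed.

(** [adjoint] is a choice, determined only when the form separates points. Submodules and direct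
    sums carry no axioms on their forms, so this is a hypothesis. *)
Lemma adjoint_eq {E F : innerModType A} (T : E -> F) (S : F -> E) :
  (forall x y : E, (forall z, inner z x = inner z y :> A) -> x = y) ->
  is_adjoint T S -> adjoint T = S.
Proof.
move=> injr TS; apply/funext => y; apply: injr => x.
by have /(_ x y) <- := xgetPex (fun=> 0) (ex_intro _ S TS); exact: TS.
Qed.

Lemma op_inv_eq {E : innerModType A} (b S : E -> E) : adjointable S ->
  (forall x, S (b x) = x) -> (forall x, b (S x) = x) -> op_inv b = S.
Proof.
move=> aS Sb bS; have [|_ Tb _] := @xgetPex _ (fun=> 0)
  [set T | [/\ adjointable T, T \o b = idfun & b \o T = idfun]].
  by exists S; split=> //; apply/funext.
apply/funext => x; rewrite -{1}(bS x).
by have := congr1 (@^~ (S x)) Tb.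
Qed.

End Submodules.

(** * Identification of the matched projection with an operator on H *)

Section MatchedProjectionOperator.
Context {R : realType} {A : cstarAlgType R} {H : hilbertModType A}.
Variables (q K r r' rho rho' P N X X' M : adjop H H).
Let q' := adjop_adj q.
Hypothesis qd : idem_data q q' K r r' rho rho'.
Hypothesis PE : P = r' * r' * (q * q').
Hypothesis N1 : N * (1 + r) = 1.
Hypothesis NC : forall Z, Z * r = r * Z -> Z * N = N * Z.
Hypothesis XE : X = r * P + q.
Hypothesis X'E : X' = r * P + q'.
Hypothesis ME : M = rop 2^-1 * (r' * N * (X' * X)).

Let Pq : P * q = q := rproj_idem qd PE.
Let qP : q * P = P := idem_rproj qd PE.
Let P_sa : adjop_adj P = P := rproj_sa qd PE.
Let PP : P * P = P := rprojP qd PE.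
Let Pr : P * r = r * P := rproj_rC qd PE.
Let q'P : q' * P = q'. Proof. by rewrite -P_sa -adjM Pq. Qed.
Let Pq' : P * q' = P. Proof. by rewrite -{1}P_sa -adjM qP. Qed.
Let q'q' : q' * q' = q'. Proof. by rewrite -adjM (id_idem qd). Qed.

Lemma range_proj_op : range_proj q = P :> (H -> H).
Proof.
have Pproj : is_projection P /\ range P = range q.
  split; first split.
  - exact: adjopP.
  - by apply/funext => x; rewrite -[RHS](congr1 (fun T : adjop H H => T x) PP).
  - by apply/funext => x; rewrite -[in RHS]P_sa.
  - apply/seteqP; split; first exact/range_subset_op/esym/qP.
    exact/range_subset_op/esym/Pq.
have [[aS SS Ssa] rS] := xgetPex (fun=> 0)
  (ex_intro [set P | is_projection P /\ range P = range q] (adjop_fun P) Pproj).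
move: aS SS Ssa rS; rewrite -/(range_proj q); set f := range_proj q => aS SS Ssa rS.
pose S := Adjop aS; have {}SS : S * S = S.
  by apply: adjop_ext => x; rewrite -[RHS](congr1 (@^~ x) SS).
have {}Ssa : adjop_adj S = S by apply: adjop_ext => x; rewrite -[RHS](congr1 (@^~ x) Ssa).
(* Projections with equal ranges satisfy S P = P and P S = S; taking adjoints gives P = S. *)
have fixes (T1 T2 : adjop H H) : T1 * T1 = T1 -> range T1 = range T2 -> T1 * T2 = T2.
  move=> T11 r12; apply: adjop_ext => x; rewrite opME.
  have [y _ <-] : range T1 (T2 x) by rewrite r12; exists x.
  by rewrite -opME T11.
have rSP : range S = range P by rewrite Pproj.2.
have -> : P = S; last by [].
by rewrite -P_sa -(fixes _ _ SS rSP) adjM P_sa Ssa (fixes _ _ PP (esym rSP)).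
Qed.

Notation V := (range_mod q).
Notation W := (null_mod (adjop_adj q)).

Let valV (v : V) : P (\val v) = \val v.
Proof.
have /asboolP[y <-] := valP v.
by rewrite -opME Pq.
Qed.

Let insubV (x : H) : P x = x -> \val (insubd 0 x : V) = x.
Proof.
move=> Px; rewrite insubdK //; apply/asboolP; exists (P x).
by rewrite -opME qP Px.
Qed.

Let valW (w : W) : q' (\val w) = 0.
Proof. exact/eqP/(valP w). Qed.

Let insubW (x : H) : q' x = 0 -> \val (insubd 0 x : W) = x.
Proof. by move=> q'x; rewrite insubdK //; apply/eqP. Qed.

(** The restriction of [T] to R(q): if [T] commutes with [P] it preserves R(q), and the default of
    [insubd] does not occur. *)
Definition onV (T : adjop H H) : V -> V := fun v => insubd 0 (T (\val v)).

Let val_onV (T : adjop H H) v : T * P = P * T -> \val (onV T v) = T (\val v).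
Proof.
move=> TP; apply: insubV.
by rewrite -opME -TP opME valV.
Qed.

Let onV_adj (T : adjop H H) : T * P = P * T -> is_adjoint (onV T) (onV (adjop_adj T)).
Proof.
move=> TP u v; rewrite /inner /= val_onV // val_onV ?adjP //.
by rewrite -{1}P_sa -adjM -TP adjM P_sa.
Qed.

Let val_A (w : W) : \val (matched_A q w) = q (\val w) - P (\val w).
Proof.
rewrite /matched_A range_proj_op insubV // adjop_subr.
by rewrite -!opME Pq PP.
Qed.

(** The adjoint of A: <(q - P) w, v> = <w, q' v - v> because P v = v, and q' v - v lies in N(q')
    because q' is idempotent. *)
Let adjA (v : V) : W := insubd 0 (q' (\val v) - \val v).

Let val_adjA (v : V) : \val (adjA v) = q' (\val v) - \val v.
Proof. by rewrite insubW // adjop_subr -opME q'q' subrr. Qed.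

Let adjoint_A : adjoint (matched_A q) = adjA.
Proof.
apply: adjoint_eq => [|w v]; first exact: submod_inner_injr.
rewrite /inner /= val_A val_adjA innerBl innerBr adjP; congr (_ - _).
by rewrite adjP P_sa valV.
Qed.

Let q_val (v : V) : q (\val v) = \val v.
Proof. by rewrite -[RHS]valV -[in RHS]qP opME valV. Qed.

(** By [rprojE] this is also the restriction of [K] to R(q), whence B is the restriction of [r]. *)
Let val_AA (v : V) :
  \val ((matched_A q \o adjoint (matched_A q) + idfun) v) = (q * q') (\val v).
Proof.
rewrite -[LHS]/(\val (matched_A q (adjoint (matched_A q) v)) + \val v).
rewrite adjoint_A val_A val_adjA !adjop_subr q_val valV.
have -> : P (q' (\val v)) = \val v by rewrite -opME Pq' valV.
by rewrite subrr subr0 addrNK.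
Qed.

Let rP : r * P = P * r. Proof. by rewrite Pr. Qed.
Let rhoP : rho * P = P * rho. Proof. by rewrite (rproj_rhoC qd PE). Qed.
Let r'P : r' * P = P * r'. Proof. by rewrite (rproj_rVC qd PE). Qed.

Lemma matched_B_eq : matched_B q = onV r.
Proof.
have hr : op_positive (onV r) /\ iter 2 (onV r) = matched_A q \o adjoint (matched_A q) + idfun.
  split.
    exists (onV rho); first by exists (onV (adjop_adj rho)); exact: onV_adj.
    rewrite (adjoint_eq (@submod_inner_injr _ _ _ _) (onV_adj rhoP)) (id_rho_sa qd).
    by apply/funext => v; apply: val_inj; rewrite /= !val_onV // -(id_r qd).
  apply/funext => v; apply: val_inj; rewrite val_AA -[LHS]/(\val (onV r (onV r v))).
  rewrite !val_onV // -opME (id_rr qd).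
  by rewrite -(rprojE qd PE) opME valV.
have [[C aC SC] SS] := xgetPex (fun=> 0) (ex_intro
  [set S | op_positive S /\ iter 2 S = matched_A q \o adjoint (matched_A q) + idfun] (onV r) hr).
move: SC SS; rewrite -/(op_root _ _) -/(matched_B q); set S := matched_B q => SC SS.
have CC' : is_adjoint C (adjoint C) := xgetPex (fun=> 0) aC.
set C' := adjoint C in SC CC'.
(* Uniqueness of the root is known on H only. So [C] is extended by zero on the complement of R(q)
   to an operator [L], for which L^* L is a positive root of q q'. *)
pose pi (x : H) : V := insubd 0 (P x).
have val_pi x : \val (pi x) = P x by rewrite insubV // -opME PP.
have pi_val v : pi (\val v) = v by apply: val_inj; rewrite val_pi valV.
have lift_adj : is_adjoint (fun x => \val (C (pi x))) (fun x => \val (C' (pi x))).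
  move=> x y; rewrite -valV adjP P_sa -val_pi; rewrite [LHS](CC' (pi x) (pi y)).
  by rewrite /inner /= val_pi adjP P_sa valV.
pose L := Adjop (ex_intro _ _ lift_adj).
have adjL y : adjop_adj L y = \val (C' (pi y)).
  by apply: inner_injr => z; rewrite -adjP; exact: lift_adj.
have LL x : (adjop_adj L * L) x = \val (S (pi x)).
  by rewrite opME adjL -[L x]/(\val (C (pi x))) pi_val SC.
have L4 : adjop_adj L * L * (adjop_adj L * L) = q * q'.
  apply: adjop_ext => x; rewrite opME !LL pi_val.
  have -> : S (S (pi x)) = (matched_A q \o adjoint (matched_A q) + idfun) (pi x) by rewrite -SS.
  by rewrite val_AA val_pi -opME -mulrA q'P.
have LrP := abs_adj_uniq qd PE erefl L4.
apply/funext => v; apply: val_inj; rewrite val_onV //.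
by rewrite -{1}(pi_val v) -LL LrP opME valV.
Qed.

Let onV_comp (S T : adjop H H) v : S * P = P * S -> T * P = P * T ->
  onV S (onV T v) = onV (S * T) v.
Proof.
move=> SP TP; apply: val_inj; rewrite !val_onV // -?opME //.
by rewrite -mulrA TP mulrA SP mulrA.
Qed.

Let onV1 v : onV 1 v = v.
Proof. by apply: val_inj; rewrite val_onV // mul1r mulr1. Qed.

Let onV_inv (S T : adjop H H) : S * P = P * S -> T * P = P * T -> S * T = 1 -> T * S = 1 ->
  op_inv (onV S) = onV T.
Proof.
move=> SP TP ST TS; apply: op_inv_eq.
- by exists (onV (adjop_adj T)); exact: onV_adj.
- by move=> v; rewrite onV_comp // TS onV1.
- by move=> v; rewrite onV_comp // ST onV1.
Qed.

Let NP : N * P = P * N. Proof. by rewrite NC. Qed.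
Let dP : r' * N * P = P * (r' * N).
Proof. by rewrite -mulrA NP mulrA r'P -mulrA. Qed.
Let sP : r * (1 + r) * P = P * (r * (1 + r)).
Proof. by rewrite -mulrA mulrDl mul1r rP -[P + _]/(P + P * r) -{1}[P]mulr1 -mulrDr !mulrA rP. Qed.

(** Orthogonality of the summands enters as P w = 0 on N(q'), which holds because [P] ends in the
    factor q'. *)
Lemma adjoint_unitary : adjoint (matched_unitary q) = fun u => \val u.1 + \val u.2.
Proof.
apply: adjoint_eq => [x y xy|x [v w]]; first by apply: inner_injr => z; exact: xy.
rewrite -[LHS]/(inner (\val (insubd 0 (range_proj q x) : V)) (\val v)
  + inner (\val (insubd 0 (x - range_proj q x) : W)) (\val w)) range_proj_op.
rewrite insubV; last by rewrite -opME PP.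
rewrite insubW; last by rewrite adjop_subr -opME q'P subrr.
rewrite innerDr adjP P_sa valV; congr (_ + _).
rewrite innerBl adjP P_sa (_ : P (\val w) = 0) ?inner0r ?subr0 //.
by rewrite PE opME [(q * q') _]opME valW !linear0.
Qed.

Lemma matched_projection_op : matched_projection q = M.
Proof.
rewrite /matched_projection; case: asboolP => [[_ _ q_sa]|_].
  (* For a projection K = 1, so (1 + r)(r - 1) = 0; as 1 + r is invertible, r = 1 and M = q. *)
  have qq' : q = q' by apply: adjop_ext => x; rewrite -[LHS](congr1 (@^~ x) q_sa).
  have K1 : K = 1.
    rewrite (id_K qd) -qq'.
    have -> : (q + q - 1) * (q + q - 1)
        = 1 + (1 + 1) * (1 + 1) * (q * q - q) by ncring.
    by rewrite (id_idem qd) subrr mulr0 addr0.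
  have r1 : r = 1.
    apply/eqP; rewrite -subr_eq0; apply/eqP.
    have <- : N * ((1 + r) * (r - 1)) = r - 1 by rewrite mulrA N1 mul1r.
    have -> : (1 + r) * (r - 1) = r * r - 1 by ncring.
    by rewrite (id_rr qd) K1 subrr mulr0.
  by rewrite (matched_op_self qd PE N1 XE X'E ME).
have NB : op_inv (matched_B q) = onV r'.
  by rewrite matched_B_eq; apply: onV_inv => //; [exact: idem_rK qd | exact: idem_rVK qd].
have bS v : ((matched_B q + idfun) v) = onV (r + 1) v.
  have r1P : (r + 1) * P = P * (r + 1) by rewrite mulrDl mulrDr mul1r mulr1 rP.
  apply: val_inj; rewrite (val_onV _ r1P) opDE op1E matched_B_eq.
  by rewrite -[LHS]/(\val (onV r v) + \val v) val_onV.
have r1r : (1 + r) * r = r * (1 + r) by rewrite mulrDl mulrDr mul1r mulr1.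
have N1' : (1 + r) * N = 1 by rewrite (NC r1r) N1.
have ND : op_inv (matched_B q \o (matched_B q + idfun)) = onV (r' * N).
  have -> : matched_B q \o (matched_B q + idfun) = onV (r * (1 + r)).
    apply/funext => v; rewrite /= bS matched_B_eq onV_comp //; first by rewrite addrC.
    by rewrite mulrDl mulrDr mul1r mulr1 rP.
  apply: onV_inv => //.
    have -> : r' * N = N * r' by rewrite NC // (idem_rVK qd) (idem_rK qd).
    by rewrite mulrA -(mulrA r) N1' mulr1 (idem_rK qd).
  have -> : r * (1 + r) = (1 + r) * r by rewrite mulrDl mulrDr mul1r mulr1.
  by rewrite mulrA -(mulrA r') N1 mulr1 (idem_rVK qd).
apply/funext => x; rewrite adjoint_unitary.
pose v : V := insubd 0 (P x); pose w : W := insubd 0 (x - P x).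
have vE : \val v = P x by rewrite insubV // -opME PP.
have wE : \val w = x - P x by rewrite insubW // adjop_subr -opME q'P subrr.
have AwE : \val (matched_A q w) = (q - P) x.
  rewrite val_A wE !adjop_subr -!opME qP PP subrr subr0.
  by rewrite opDE opNE.
have Ux : matched_unitary q x = (v, w) by rewrite /matched_unitary range_proj_op.
have valD (p : submodClosed H) (a b : submod p) : \val (a + b) = \val a + \val b by [].
have valZ (p : submodClosed H) (k : R[i]) (a : submod p) : \val (k *: a) = k *: \val a by [].
transitivity (\val ((2^-1 : R[i]) *: (matched_block q (matched_unitary q x)).1)
  + \val ((2^-1 : R[i]) *: (matched_block q (matched_unitary q x)).2)); first by [].
rewrite Ux !valZ -scalerDr.
have -> : (matched_block q (v, w)).1 = onV (r + 1) (onV r' v) + onV r' (matched_A q w).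
  by rewrite -NB -bS.
have -> : (matched_block q (v, w)).2 = adjA (onV r' v) + adjA (onV (r' * N) (matched_A q w)).
  by rewrite -adjoint_A -NB -ND.
have r1P : (r + 1) * P = P * (r + 1) by rewrite mulrDl mulrDr mul1r mulr1 rP.
rewrite !valD !val_adjA !val_onV // AwE vE.
have -> : M = rop 2^-1 * (r' * (1 + r) * P + r' * (q - P) + (q' - P) * r'
    + (q' - P) * (r' * N * (q - P))).
  by apply: (matched_op_block qd PE N1 NC XE X'E ME).
(* The lower blocks apply A^*, which acts as q' - 1; on R(q) this agrees with q' - P. *)
have -> : (q' - P) * r' = q' * (r' * P) - r' * P.
  by rewrite r'P mulrA q'P mulrBl.
have -> : (q' - P) * (r' * N * (q - P)) = q' * (r' * N * (q - P)) - r' * N * (q - P).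
  have PV : P * (q - P) = q - P by rewrite mulrBr Pq PP.
  by rewrite [LHS]mulrBl (mulrA P) -dP -[r' * N * P * _]mulrA PV.
have -> : r' * (1 + r) * P = (r + 1) * (r' * P).
  by rewrite mulrDr mulr1 (idem_rVK qd) mulrDl [RHS]mulrDl !mul1r mulrA (idem_rK qd) mul1r addrC.
rewrite [RHS]opME [RHS]ropE fmorphV rmorph_nat; congr (_ *: _).
rewrite !opDE !opNE !opME -!addrA; congr (_ + _); congr (_ + _).
Qed.

End MatchedProjectionOperator.

(** * Absolute values, roots and equality of ranges *)

Section RangeEquality.
Context {R : realType} {A : cstarAlgType R} {H : hilbertModType A}.

(** The root chosen by [op_abs] is identified through uniqueness; exchanging [q] and [q'] also
    yields |Q|. *)
Lemma op_abs_adj (q q' K r r' rho rho' P : adjop H H) :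
  idem_data q q' K r r' rho rho' -> P = r' * r' * (q * q') -> op_abs q' = r * P :> (H -> H).
Proof.
move=> qd PE; have [ex_adj ex_sqr] := abs_adj_ex qd PE.
have -> : op_abs q' = op_root 2 (q * q').
  by rewrite -[in RHS](id_adj (idem_data_sym qd)).
have [|S [C [-> SC S2]]] := @op_rootP _ _ _ 2%N (q * q') _ _ ex_adj.
  by rewrite expr2 ex_sqr.
have {}S2 : S * S = q * q' by apply: adjop_ext => x; rewrite -expr2 S2.
by rewrite (abs_adj_uniq qd PE SC S2).
Qed.

Lemma range_eq_op (S T Y Z : adjop H H) : S = T * Y -> T = S * Z -> range S = range T.
Proof. by move=> /range_subset_op ST /range_subset_op TS; apply/seteqP. Qed.

(** A positive root is exhibited only to ensure that [op_root] returns one. For the root [S]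
    returned, M = S Y for some [Y] and S = M S, whence equal ranges. *)
Lemma range_op_root (M r N rho T : adjop H H) n : (0 < n)%N ->
  M * M = M -> adjop_adj M = M -> adjop_adj rho = rho -> rho * rho = r -> M * r = r * M ->
  M * N = N * M -> (1 + r) * N = 1 ->
  T = rop 2^-1 * ((1 + r) * M) ->
  range M = range (op_root n T).
Proof.
case: n => // n _ MM M_sa rho_sa rhoE Mr MN N1 TE.
have idem_r_sa : adjop_adj r = r by rewrite -rhoE adjM rho_sa.
have hsa : adjop_adj (rop 2^-1 * r) = rop 2^-1 * r by rewrite adjM adj_rop idem_r_sa ropC.
have r_pos : pos (rop 2^-1 * r) by apply: posZ; rewrite ?invr_ge0 // -rhoE; exact: pos_sqr.
have h0 : 0 < 2^-1 :> R by rewrite invr_gt0.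
(* The exponent is doubled so that Z^2, a positive operator, is the wanted root of (1 + r)/2; then
   Z^2 M is a positive root of [T]. *)
have [Z [[Zsa Zcomm] Zn]] := @pos_root _ _ _ (2 * n.+1)%N _ _ isT h0 hsa r_pos.
have MZ : M * Z = Z * M by apply: Zcomm; rewrite ropCA Mr mulrA.
have MX k : M ^+ k.+1 = M by elim: k => [|k IH]; rewrite ?expr1 // exprS IH.
have ex_adj : Z * Z * M = adjop_adj (Z * M) * (Z * M).
  by rewrite adjM Zsa M_sa MZ -[RHS]mulrA (mulrA M) MZ -(mulrA Z M) MM mulrA.
have ex_pow : (Z * Z * M) ^+ n.+1 = T.
  have ZZM : (Z * Z) * M = M * (Z * Z) by rewrite -mulrA -MZ mulrA -MZ mulrA.
  by rewrite exprMn_comm // MX -expr2 -exprM Zn TE mulrDl mulrDl mulrDr mul1r mulrA.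
have [|S [C [-> SC Sn]]] := @op_rootP _ _ _ n.+1 T _ _ ex_adj; first by rewrite ex_pow.
have {}Sn : S ^+ n.+1 = T by apply: adjop_ext => x; rewrite Sn.
have Ssa : adjop_adj S = S by rewrite SC adjM_selfadj.
apply: (@range_eq_op M S (S ^+ n * (rop 2 * N)) S).
  rewrite mulrA -exprS Sn TE ropCA -!mulrA MN (mulrA _ N) N1 mul1r mulrA -ropM.
  by rewrite mulfV ?pnatr_eq0 // rop1 mul1r.
(* A power of the self-adjoint [S] kills 1 - M, hence so does [S]; the adjoint of S = S M is S = M
   S. *)
have SM : S * (1 - M) = 0.
  apply: (@selfadj_exp_eq0 _ _ _ S _ n) => //.
  by rewrite Sn TE -!mulrA mulrBr mulr1 MM subrr !mulr0.
have {}SM : S = S * M by apply/eqP; rewrite -subr_eq0 -{1}[S]mulr1 -mulrBr SM.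
by rewrite -{1}Ssa {1}SM adjM M_sa Ssa.
Qed.

End RangeEquality.

Unset Implicit Arguments.
Set Strict Implicit.
Set Printing Implicit Defensive.

Theorem corollary3p13 (R : realType) (A : cstarAlgType R)
    (H : hilbertModType A) (Q : adjop H H) (Qidem : Q \o Q = Q) :
  range (matched_projection Q)
    = range (op_abs (adjoint Q) + op_abs Q + (Q : H -> H) + adjoint Q)
  /\ forall n : nat, (0 < n)%N ->
       range (op_abs (adjoint Q) + op_abs Q + (Q : H -> H) + adjoint Q)
         = range (op_root n
             (matched_projection Q \o Q \o matched_projection Q)).
Proof.
have QQ : Q * Q = Q by apply: adjop_ext => x; rewrite -[RHS](congr1 (@^~ x) Qidem).
have [K [r [r' [rho [rho' qd]]]]] := idem_data_ex QQ.
set Q' := adjop_adj Q in qd.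
have idem_r_sa : adjop_adj r = r := idem_r_sa qd.
have rpos : pos r by rewrite -(id_r qd); apply: pos_sqr; exact: id_rho_sa qd.
(* [N] is the inverse of 1 + r, and commutes with everything that commutes with [r]. *)
have [N [[_ NC] N1 N2]] := pos_inv ltr01 idem_r_sa rpos; rewrite rop1 in N1 N2.
(* Variables rather than local definitions, which the associativity rewrites
   would unfold. *)
have [P PE] : exists P, P = r' * r' * (Q * Q') by eexists.
have [P1 P1E] : exists P1, P1 = r' * r' * (Q' * Q) by eexists.
have [X XE] : exists X, X = r * P + Q by eexists.
have [X' X'E] : exists X', X' = r * P + Q' by eexists.
have [M ME] : exists M, M = rop 2^-1 * (r' * N * (X' * X)) by eexists.
have -> : matched_projection Q = M by exact: matched_projection_op qd PE N2 NC XE X'E ME.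
have -> : op_abs (adjoint Q) + op_abs Q + (Q : H -> H) + adjoint Q
    = (r * P + r * P1 + Q + Q' : adjop H H).
  rewrite -[adjoint Q]/(adjop_fun Q') (op_abs_adj qd PE).
  by rewrite (op_abs_adj (idem_data_sym qd) P1E).
have Mr : M * r = r * M by exact: (matched_op_comm qd PE NC XE X'E ME).
have MN := NC _ Mr.
have MM : M * M = M by apply: (matched_op_idem qd PE N2 NC XE X'E ME).
have sumE := matched_op_sum qd PE P1E N2 NC XE X'E ME erefl erefl.
have r1M : (1 + r) * M = M * (1 + r) by rewrite mulrDl mulrDr Mr mul1r mulr1.
have rM : range M = range (r * P + r * P1 + Q + Q').
  (* The sum is 2 (1 + r) M; the invertible factor commutes with [M], so it and its inverse can be
     moved to the right. *)
  apply: (@range_eq_op _ _ _ _ _ (rop 2^-1 * N) (rop 2 * (1 + r))).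
    rewrite sumE ropCA -!mulrA MN (mulrA _ N) N1 mul1r mulrA -ropM.
    by rewrite mulVf ?pnatr_eq0 // rop1 mul1r.
  by rewrite sumE r1M -ropCA.
split=> [//|n n0]; rewrite -rM.
have rho_sa : adjop_adj rho = rho := id_rho_sa qd.
have M_sa : adjop_adj M = M by exact: (matched_op_sa qd PE N2 NC XE X'E ME).
apply: (@range_op_root _ _ _ M r N rho (M * Q * M)) => //; first exact: id_r qd.
exact: (matched_op_compress qd PE N2 NC XE X'E ME).
Qed.
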